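(* Fix an integer $p\ge 1$. For each integer $n\ge 2$ let $m_n\in\{1,\dots,n-1\}$ and let $k_n\ge0$ be an integer, and assume that, as $n\to\infty$, $$\lambda_n=n\left(\frac{n-m_n}{n}\right)^{k_n}\longrightarrow\lambda\in(0,\infty),\qquad n-m_n\longrightarrow\infty .$$ Let $M_n=(Q_{n,p}^{(m_n)})^{*k_n}$ be the law on $G_{n,p}=C_p\wr S_n$ of $k_n$ steps of the $p$-colored top-$m_n$-to-random shuffle and let $U_n=U_{n,p}$ be the uniform distribution on $G_{n,p}$. Then for every continuous function $\Phi:[0,\infty)\to\mathbb{R}$ of polynomial growth, $$\mathcal I_\Phi(M_n,U_n)\longrightarrow \mathcal I_{\Phi,p}(\lambda):=\sum_{\ell=0}^\infty a_{\ell,p}\,\Phi(s_{\ell,p}(\lambda)).$$ In particular, with $c=-\log\lambda$, $$\lVert M_n-U_n\rVert_{\mathrm{TV}}\longrightarrow f_p(c),\qquad f_p(c):=\sum_{\ell=0}^\infty a_{\ell,p}\bigl(s_{\ell,p}(e^{-c})-1\bigr)_+ .$$ Moreover, $$\mathrm{sep}(M_n,U_n)\longrightarrow\begin{cases}1-e^{-\lambda}(1+\lambda),&p=1,\\ 1-e^{-\lambda},&p\ge2.\end{cases}$$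
   Context: $G_{n,p}=C_p\wr S_n\cong C_p^n\rtimes S_n$ is the group of $p$-colored permutations, thought of as arrangements of a deck of $n$ cards labelled $1,\dots,n$, each card carrying a color in $C_p=\mathbb{Z}/p\mathbb{Z}$; the identity is the deck in order $1,2,\dots,n$ from top to bottom with all colors $0$. One step of the $p$-colored top-$m$-to-random shuffle ($1\le m\le n$): remove the top $m$ cards, recolor those $m$ cards by independent uniform elements of $C_p$, apply a uniform random permutation to the removed block, choose an $m$-element set of final positions uniformly among all $\binom nm$ possibilities, and insert the removed cards into those positions; the remaining $n-m$ cards preserve their relative order and color. $Q_{n,p}^{(m)}$ is the one-step law on $G_{n,p}$, and $(Q_{n,p}^{(m)})^{*k}$ is its $k$-fold convolution power, i.e. the law of the deck after $k$ independent steps started from the identity (point mass at the identity if $k=0$). For a probability measure $M$ on $G_{n,p}$ and $U=U_{n,p}$ uniform: $\mathcal I_\Phi(M,U)=\sum_{x}U(x)\,\Phi\!\left(\frac{M(x)}{U(x)}\right)$; $\lVert M-U\rVert_{\mathrm{TV}}=\frac12\sum_x|M(x)-U(x)|$; $\mathrm{sep}(M,U)=\max_x\left(1-\frac{M(x)}{U(x)}\right)$. Polynomial growth means $|\Phi(t)|\le C(1+t^d)$ for all $t\ge0$, for some $C>0$, $d\ge0$. Also $y_+=\max(y,0)$, and for $\ell\ge0$, $\lambda>0$, $$a_{\ell,p}=\frac1{\ell!\,p^\ell}-\frac1{(\ell+1)!\,p^{\ell+1}},\qquad s_{\ell,p}(\lambda)=e^{-\lambda}\sum_{u=0}^{\ell}(p\lambda)^u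 .$$ *)

(* Defs.v *)
From HB Require Import structures.
From mathcomp Require Import all_boot all_order all_algebra all_fingroup.
From mathcomp Require Import all_classical all_reals all_analysis.
Set Implicit Arguments.
Unset Strict Implicit.
Unset Printing Implicit Defensive.
Import Order.TTheory GRing.Theory Num.Theory.
Import numFieldNormedType.Exports.
Local Open Scope classical_set_scope.
Local Open Scope ring_scope.

(* The cyclic group Z/p for p >= 1.  ('Z_p is not usable here: 'Z_1 is Z/2.) *)
Definition color (p : nat) := 'I_p.-1.+1.

(* The wreath product C_p wr S_n, read as the decks of n colored cards: in the
   deck x, card i has color x.1 i and sits at position x.2 i (cards and
   positions are numbered from 0, position 0 being the top).  As a step, x adds
   x.1 j to the color of the card at position j and moves it to position x.2 j;
   x * y is the deck obtained from the deck x by the step y. *)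
Definition wreath (n p : nat) : Type := ({ffun 'I_n -> color p} * 'S_n)%type.
HB.instance Definition _ n p := Finite.on (wreath n p).

Section WreathGroup.
Variables n p : nat.
Implicit Types x y : wreath n p.

Definition wreath_mul x y : wreath n p :=
  ([ffun i => x.1 i + y.1 (x.2 i)], (x.2 * y.2)%g).

Definition wreath_one : wreath n p := ([ffun=> 0], 1%g).

Definition wreath_inv x : wreath n p :=
  ([ffun i => - x.1 ((x.2)^-1%g i)], (x.2)^-1%g).

Lemma wreath_mulA : associative wreath_mul.
Proof.
move=> x y z; congr pair; last exact: mulgA.
by apply/ffunP=> i; rewrite !ffunE permM addrA.
Qed.

Lemma wreath_mul1 : left_id wreath_one wreath_mul.
Proof.
move=> [f s]; congr pair; last exact: mul1g.
by apply/ffunP=> i; rewrite !ffunE perm1 add0r.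
Qed.

Lemma wreath_mulV : left_inverse wreath_one wreath_inv wreath_mul.
Proof.
move=> [f s]; congr pair; last exact: mulVg.
by apply/ffunP=> i; rewrite !ffunE /= addNr.
Qed.

HB.instance Definition _ := Finite_isGroup.Build (wreath n p)
  wreath_mulA wreath_mul1 wreath_mulV.
End WreathGroup.

Section Shuffle.
Variables n p m : nat.

Definition top_block : {set 'I_n} := [set i : 'I_n | (i < m)%N]%SET.

(* For #|A| = m: the cards at positions 0, ..., m-1 are sent in order to the
   positions in A, and the others in order to the positions outside A (enum
   lists the elements of a set of ordinals increasingly). *)
Definition insertion_fun (A : {set 'I_n}) (i : 'I_n) : 'I_n :=
  nth i (enum A ++ enum (~: A)%SET) i.

Lemma insertion_inj (A : {set 'I_n}) : injective (insertion_fun A).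
Proof.
move=> i j; rewrite /insertion_fun; set s := (_ ++ _).
have Us : uniq s.
  rewrite cat_uniq !enum_uniq andbT /=; apply/hasPn=> x.
  by rewrite !mem_enum inE.
have Ss : size s = n by rewrite size_cat -!cardE cardsC card_ord.
rewrite (set_nth_default j i) ?Ss // => /eqP.
by rewrite nth_uniq ?Ss // => /eqP /val_inj.
Qed.

Definition insertion (A : {set 'I_n}) : 'S_n := perm (@insertion_inj A).

(* The outcomes (c, s, A) of the random choices made in one step: colors c for
   the top block, a permutation s of it, and the set A of its m final
   positions. *)
Definition shuffle_choices :
    {set {ffun 'I_n -> color p} * 'S_n * {set 'I_n}} :=
  [set w : {ffun 'I_n -> color p} * 'S_n * {set 'I_n} |
     [&& [forall (i | i \notin top_block), w.1.1 i == 0],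
         perm_on top_block w.1.2 & #|w.2| == m]]%SET.

Definition shuffle_step
    (w : {ffun 'I_n -> color p} * 'S_n * {set 'I_n}) : wreath n p :=
  (w.1.1, (w.1.2 * insertion w.2)%g).

Definition shuffle_law (R : realType) (x : wreath n p) : R :=
  #|[set w in shuffle_choices | shuffle_step w == x]%SET|%:R
  / #|shuffle_choices|%:R.
End Shuffle.

Section Laws.
Variables (R : realType) (gT : finGroupType).
Implicit Types M N U : gT -> R.

Definition unif_law (x : gT) : R := #|gT|%:R^-1.

Definition convolution M N (x : gT) : R := \sum_(y : gT) M y * N (y^-1 * x)%g.

Definition convolution_pow M (k : nat) : gT -> R :=
  iter k (fun N => convolution N M) (fun x => (x == 1%g)%:R).

Definition phi_div (Phi : R -> R) M U : R :=
  \sum_(x : gT) U x * Phi (M x / U x).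

Definition tv_dist M U : R := 2^-1 * \sum_(x : gT) `|M x - U x|.

(* The maximum over the group; the start value of the iteration is one of the
   values compared, so it does not affect the result. *)
Definition sep_dist M U : R :=
  \big[Num.max/1 - M 1%g / U 1%g]_(x : gT) (1 - M x / U x).
End Laws.
Arguments unif_law R {gT} x.

Section Limits.
Variable R : realType.

(* Phi is only ever used on [0, +oo[. *)
Definition poly_growth (Phi : R -> R) : Prop :=
  exists C d : R, [/\ 0 < C, 0 <= d &
    forall t : R, 0 <= t -> `|Phi t| <= C * (1 + t `^ d)].

Definition a_coef (p l : nat) : R :=
  (l`!%:R * p%:R ^+ l)^-1 - ((l.+1)`!%:R * p%:R ^+ l.+1)^-1.

Definition s_level (p : nat) (lam : R) (l : nat) : R :=
  expR (- lam) * \sum_(0 <= u < l.+1) (p%:R * lam) ^+ u.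

Definition phi_lim_term (Phi : R -> R) (p : nat) (lam : R) (l : nat) : R :=
  a_coef p l * Phi (s_level p lam l).

Definition phi_lim (Phi : R -> R) (p : nat) (lam : R) : R :=
  limn (series (phi_lim_term Phi p lam)).

Definition tv_profile_term (p : nat) (c : R) (l : nat) : R :=
  a_coef p l * Num.max (s_level p (expR (- c)) l - 1) 0.

Definition tv_profile (p : nat) (c : R) : R :=
  limn (series (tv_profile_term p c)).
End Limits.

(* Main.v *)
Require Import Defs.
From mathcomp Require Import all_boot all_order all_algebra all_fingroup.
From mathcomp Require Import all_classical all_reals all_analysis.
From mathcomp Require Import zify ring lra.
Import Order.TTheory GRing.Theory Num.Theory.
Import numFieldNormedType.Exports.
Local Open Scope classical_set_scope.
Local Open Scope ring_scope.

Set Implicit Arguments.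
Unset Strict Implicit.
Unset Printing Implicit Defensive.

(** At any time the cards that no step has touched yet are the bottom [j] cards
of the initial deck, for some [j]: they still have color 0 and still follow
each other in the initial order, while everything else about the deck is
uniformly random. So, given that [j] cards are untouched, the deck is uniform
among those in which the last [j] labels have color 0 and increasing positions
([bottom_law]). Each step preserves this description: it touches [a] of the [j]
untouched cards with the hypergeometric probability [hypergeom]
([convolution_bottom_law]). By induction the law after [k] steps is the mixture
of the [bottom_law j] with weights [untouched_law n m k j] ([shuffle_pow_law]).

A fraction [1 / (j! p^j)] of all decks has the last [j] labels uncolored and in
order, because every deck can be brought into that form in exactly one way by
permuting and recoloring these labels ([card_sorting]). Let the [level] of a
deck be the largest such [j]. The density of the shuffle with respect to the
uniform law at a deck of level [l] is then the sum over [j <= l] of [j! p^j *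
untouched_law j] ([shuffle_pow_density]), and level [l < n] has uniform
probability [a_coef p l] ([card_level]); so each of the three distances is a
function of the numbers [density l].

It remains to find the limit law of the number of untouched cards. A given set
of [r] cards avoids [m] random positions with probability C(n-r,m)/C(n,m), so
the factorial moments are explicit ([untouched_law_moment]) and are products of
[r] factors, each of them at most [lambda_n] and with limit [lambda]
([moment_factor_le], [cvg_moment_factor]). Inclusion-exclusion recovers the law
from the moments, and dominated convergence for series ([tannery]) gives the
Poisson limit ([cvg_untouched_law]); hence [density l] tends to [s_level p
lambda l]. The moment bound also yields [density l <= (1 + p (lambda + 1))^l]
for large [n], which the weights [1 / l!] of the levels dominate even after
applying a function of polynomial growth, so a second use of [tannery] gives
the limit of the divergences ([cvg_phi_div]). The total variation distance is
the divergence of [max (t - 1) 0]. The density does not decrease with the level, so the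
separation distance is read off at the lowest level, which is 1 if [p = 1] (a
single card is always in order) and 0 otherwise. *)

(** * Undisturbed cards and parabolic subgroups *)
Section Decks.
Local Open Scope set_scope.
Variables n p : nat.
Hypothesis p_gt0 : (0 < p)%N.
Implicit Types (B C T : {set 'I_n}) (x y v w g h : wreath n p).

Definition undisturbed C x :=
  [forall i in C, x.1 i == 0] &&
  [forall i in C, forall j in C, (i < j)%N ==> (x.2 i < x.2 j)%N].

Lemma undisturbedP C x :
  reflect ({in C, forall i, x.1 i = 0} /\
           {in C &, forall i j : 'I_n, (i < j)%N -> (x.2 i < x.2 j)%N})
          (undisturbed C x).
Proof.
apply: (iffP andP) => [[/forall_inP h1 /forall_inP h2]|[h1 h2]].
  split=> [i /h1 /eqP//|i j /h2 /forall_inP h /h]; exact: implyP.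
split; first by apply/forall_inP=> i /h1 ->.
apply/forall_inP=> i Ci; apply/forall_inP=> j Cj; apply/implyP; exact: h2.
Qed.

(** The copy of the wreath product of C_p by Sym(C) that moves and recolors
only the points of [C]. Multiplied on the left of a deck it acts on card
labels, on the right on positions. *)
Definition parabolic C : {set wreath n p} :=
  [set g : wreath n p | [forall (i | i \notin C), (g.1 i == 0) && (g.2 i == i)]].

Lemma parabolicP C g :
  reflect (forall i, i \notin C -> g.1 i = 0 /\ g.2 i = i) (g \in parabolic C).
Proof.
rewrite inE; apply: (iffP forall_inP) => h i /h.
  by case/andP => /eqP -> /eqP ->.
by case=> -> ->; rewrite !eqxx.
Qed.

Lemma wreathM1 x y i : (x * y)%g.1 i = x.1 i + y.1 (x.2 i).
Proof. by rewrite ffunE. Qed.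

Lemma wreathM2 x y i : (x * y)%g.2 i = y.2 (x.2 i).
Proof. by rewrite permM. Qed.

Lemma wreathV1 x i : (x^-1)%g.1 i = - x.1 ((x.2)^-1%g i).
Proof. by rewrite ffunE. Qed.

Lemma wreathV2 x : (x^-1)%g.2 = (x.2)^-1%g.
Proof. by []. Qed.

Lemma parabolic_group_set C : group_set (parabolic C).
Proof.
apply/group_setP; split.
  by apply/parabolicP=> i _; rewrite ffunE perm1.
move=> x y /parabolicP hx /parabolicP hy; apply/parabolicP=> i Ci.
have [x1 x2] := hx _ Ci; have [y1 y2] := hy _ Ci.
by rewrite wreathM1 wreathM2 x1 x2 y1 y2 addr0.
Qed.
Canonical parabolic_group C := Group (parabolic_group_set C).

Lemma card_color : #|color p| = p.
Proof. by rewrite card_ord prednK. Qed.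

Lemma card_wreath : #|{: wreath n p}| = (n`! * p ^ n)%N.
Proof. by rewrite card_prod card_ffun card_Sn card_color card_ord mulnC. Qed.

Lemma perm_onP C (s : 'S_n) :
  reflect (forall i, i \notin C -> s i = i) (perm_on C s).
Proof.
apply: (iffP fintype.subsetP) => h i.
  by move=> Ci; apply/eqP; apply: contraNT Ci => /h.
by rewrite inE; apply: contraR => /h ->.
Qed.

Lemma card_parabolic C : #|parabolic C| = ((#|C|)`! * p ^ #|C|)%N.
Proof.
have -> : (p ^ #|C|)%N = #|pffun_on (0 : color p) C predT|.
  by rewrite card_pffun_on card_color.
rewrite -(card_perm C) mulnC -(cardsE (pffun_on _ _ _)) -(cardsE (perm_on C)) -cardsX.
apply: eq_card => -[f s].
apply/parabolicP/setXP; rewrite !inE /=.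
  move=> h; split; last by apply/perm_onP=> i /h [].
  apply/pffun_onP; split=> //; apply/fintype.subsetP=> i.
  by rewrite inE; apply: contraR => /h [-> _].
case=> /pffun_onP [/fintype.subsetP h _] /perm_onP hs i Ci; split; last exact: hs.
by apply/eqP; apply: contraNT Ci => hi; apply: h.
Qed.

Lemma parabolicE C : parabolic C =
  [set w : wreath n p | [&& [forall (i | i \notin C), w.1 i == 0] & perm_on C w.2]].
Proof.
apply/setP=> g; apply/parabolicP/idP; rewrite inE.
  move=> h; apply/andP; split; last by apply/perm_onP=> i /h [].
  by apply/forall_inP=> i /h [-> _].
by case/andP=> /forall_inP h1 /perm_onP h2 i Ci; rewrite h2 // (eqP (h1 i Ci)).
Qed.


Lemma sorted_enum C : sorted ltn (map val (enum C)).
Proof.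
rewrite -[enum _](eq_filter (mem_enum _)).
rewrite -(eq_filter (mem_map val_inj _)) -filter_map.
by rewrite (sorted_filter ltn_trans) // unlock val_ord_enum iota_ltn_sorted.
Qed.

End Decks.

(** * Sorting a set of cards *)
Section Sorting.
Local Open Scope set_scope.
Variables n p : nat.
Implicit Types (B C T : {set 'I_n}) (x y v w g h : wreath n p).

(** Send the r-th element of [C] to the element of [C] whose image under [s] is
the r-th smallest. *)
Lemma exists_sorting_perm C (s : 'S_n) : exists2 t : 'S_n, perm_on C t &
  {in C &, forall i j : 'I_n, (i < j)%N -> (s (t i) < s (t j))%N}.
Proof.
pose e := enum C; pose leS (i j : 'I_n) := (s i <= s j)%N.
pose e' := sort leS e.
have leS_tr : transitive leS by move=> ? ? ?; exact: leq_trans.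
have leS_tot : total leS by move=> ? ?; exact: leq_total.
have e'e : perm_eq e' e by apply/permPl; exact: perm_sort.
have Ue' : uniq e' by rewrite (perm_uniq e'e) enum_uniq.
have Se' : size e' = size e by exact: perm_size.
have Ie i : i \in C -> (index i e < size e')%N.
  by rewrite Se' index_mem mem_enum.
pose t i := if i \in C then nth i e' (index i e) else i.
have tE i j : j \in C -> t j = nth i e' (index j e).
  by move=> Cj; rewrite /t Cj; apply: set_nth_default; exact: Ie.
have tC i : i \in C -> t i \in C.
  by move=> Ci; rewrite (tE i) // -mem_enum -(perm_mem e'e) mem_nth // Ie.
have t_inj : injective t.
  move=> i j; have [Ci|Ci] := boolP (i \in C); have [Cj|Cj] := boolP (j \in C).
  - rewrite (tE i) // (tE i j) // => /eqP.
    rewrite nth_uniq ?Ie // => /eqP ij.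
    have := nth_index i (s := e) (x := i); rewrite mem_enum ij => <- //.
    by rewrite nth_index // mem_enum.
  - by move=> tij; move: (tC _ Ci) Cj; rewrite tij /t; case: ifP => // ->.
  - by move=> tij; move: (tC _ Cj) Ci; rewrite -tij /t; case: ifP => // ->.
  by rewrite /t (negbTE Ci) (negbTE Cj).
exists (perm t_inj) => [|i j Ci Cj ij].
  by apply/perm_onP=> i Ci; rewrite permE /t (negbTE Ci).
have iij : (index i e < index j e)%N.
  rewrite ltnNge; apply: contraL ij; rewrite -leqNgt.
  apply: (@sorted_leq_index _ (fun i j : 'I_n => (i <= j)%N)) => //.
  - by move=> ? ? ?; exact: leq_trans.
  - have := sorted_enum C; rewrite sorted_map; apply: sub_sorted => a b.
    exact: ltnW.
  - by rewrite mem_enum.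
  - by rewrite mem_enum.
have : leS (t i) (t j).
  rewrite (tE i) // (tE i j) //.
  apply: (sorted_ltn_nth leS_tr) => //; rewrite ?inE ?Ie //.
  exact: sort_sorted.
rewrite !permE /leS leq_eqVlt => /orP[/eqP/val_inj/perm_inj/t_inj ijE|//].
by rewrite ijE ltnn in ij.
Qed.

(** Listed along [C], the values of [s \o t] and of [s \o u] are strictly
increasing sequences with the same entries. *)
Lemma sorting_perm_unique C (s t u : 'S_n) : perm_on C t -> perm_on C u ->
  {in C &, forall i j : 'I_n, (i < j)%N -> (s (t i) < s (t j))%N} ->
  {in C &, forall i j : 'I_n, (i < j)%N -> (s (u i) < s (u j))%N} -> t = u.
Proof.
move=> tC uC ts us.
pose im (v : 'S_n) := [seq val (s (v i)) | i <- enum C].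
have im_sorted (v : 'S_n) :
    {in C &, forall i j : 'I_n, (i < j)%N -> (s (v i) < s (v j))%N} ->
    sorted ltn (im v).
  move=> vs; rewrite sorted_map.
  have := sorted_enum C; rewrite sorted_map.
  by apply: (sub_in_sorted vs); apply/allP => i; rewrite mem_enum.
have mem_im (v : 'S_n) : perm_on C v -> im v =i [seq val (s i) | i <- enum C].
  move=> vC a; apply/mapP/mapP => -[i]; rewrite mem_enum => Ci ->.
    by exists (v i) => //; rewrite mem_enum perm_closed.
  rewrite -(im_perm_on vC) in Ci; have /imsetP[j Cj ->] := Ci.
  by exists j => //; rewrite mem_enum.
have im_eq : im t = im u.
  apply: (irr_sorted_eq ltn_trans ltnn (im_sorted _ ts) (im_sorted _ us)) => a.
  by rewrite !mem_im.
apply/permP=> i; have [Ci|Ci] := boolP (i \in C); last first.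
  by move/perm_onP: tC => -> //; move/perm_onP: uC => ->.
have /eq_in_map/(_ i) := im_eq; rewrite mem_enum => /(_ Ci) /val_inj.
exact: perm_inj.
Qed.

(** The [parabolic p C]-orbits on decks are free and each contains exactly one
deck that is undisturbed on [C]: all the counts below come from averaging over
such orbits. *)
Lemma card_sorting C w :
  #|[set g in parabolic p C | undisturbed C (g * w)%g]| = 1%N.
Proof.
have [t tC ts] := exists_sorting_perm C w.2.
(* outside C the color of g is 0, on C it cancels the color of the card t i *)
pose g0 : wreath n p := ([ffun i => if i \in C then - w.1 (t i) else 0], t).
apply/eqP/cards1P; exists g0; apply/setP=> g; rewrite !inE.
apply/andP/eqP => [[/forall_inP gC /undisturbedP[g1 g2]]|->]; last first.
  split; first apply/forall_inP => i /[dup] Ci /negbTE nCi.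
    by rewrite ffunE nCi eqxx /=; move/perm_onP: tC => ->.
  apply/undisturbedP; split=> [i Ci|i j Ci Cj ij].
    by rewrite wreathM1 ffunE Ci addNr.
  by rewrite !wreathM2; exact: ts.
have g2t : g.2 = t.
  apply: (@sorting_perm_unique C w.2) => //.
    by apply/perm_onP=> i /gC /andP[_ /eqP].
  by move=> i j Ci Cj ij; rewrite -!wreathM2; exact: g2.
rewrite [g]surjective_pairing g2t; congr pair; apply/ffunP=> i; rewrite ffunE.
case: ifPn => Ci; last by have /andP[/eqP] := gC _ Ci.
by apply/eqP; rewrite -addr_eq0 -g2t -wreathM1 g1.
Qed.

Lemma card_undisturbed C :
  (#|[set x : wreath n p | undisturbed C x]| * #|parabolic p C|)%N = #|{: wreath n p}|.
Proof.
transitivity (\sum_(x : wreath n p) \sum_(g in parabolic p C) undisturbed C (g * x)%g)%N.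
  rewrite exchange_big /= mulnC -sum_nat_const; apply: eq_bigr => g gC.
  by rewrite -sum1dep_card big_mkcond (reindex_inj (mulgI g)).
rewrite -sum1_card; apply: eq_bigr => x _.
by rewrite -big_mkcondr /= sum1dep_card card_sorting.
Qed.

End Sorting.

(** * Averaging over the rearrangements of a block of positions *)
Section BlockAverage.
Local Open Scope set_scope.
Variables n p : nat.
Implicit Types (B C T : {set 'I_n}) (x y v w g h : wreath n p).

(** As [v] puts the cards of [C] at positions in [T], relabeling these cards by
[g] amounts to acting on the positions by the conjugate [g ^ v], which lies in
[parabolic p T]. The count is therefore unchanged when [v] is replaced by [g *
v], and averaging over [g] reduces it to [card_sorting]. *)
Lemma card_undisturbed_block T C v : {in C, forall i, v.2 i \in T} ->
  (#|[set h in parabolic p T | undisturbed C (v * h)%g]| * #|parabolic p C| =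
   #|parabolic p T|)%N.
Proof.
move=> CT.
have conjC g : g \in parabolic p C -> (g ^ v)%g \in parabolic p T.
  move=> /parabolicP gC; apply/parabolicP=> i iT.
  have iC : (v.2)^-1%g i \notin C.
    by apply: contra iT => /CT; rewrite permKV.
  have [g1 g2] := gC _ iC.
  rewrite /conjg !wreathM1 !wreathM2 wreathV1 wreathV2 g1 g2 permKV.
  by rewrite add0r addNr.
transitivity (\sum_(h in parabolic p T) \sum_(g in parabolic p C)
   undisturbed C (g * (v * h))%g)%N; last first.
  rewrite -sum1_card; apply: eq_bigr => h _.
  by rewrite -big_mkcondr /= sum1dep_card card_sorting.
rewrite exchange_big /= mulnC -sum_nat_const; apply: eq_bigr => g gC.
rewrite -sum1dep_card big_mkcondr (reindex_inj (mulgI (g ^ v)%g)) /=.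
apply: eq_big => [h|h _]; first by rewrite groupMl // conjC.
have -> : (v * (g ^ v * h) = g * (v * h))%g by rewrite /conjg !mulgA mulgV mul1g.
by [].
Qed.

(** The step [h] rearranges only the positions in [T], which all precede the
other positions. So the cards of [B] that sit in [T] stay above those that do
not, and the latter are not affected by [h]. *)
Lemma undisturbed_block T B v h (B1 := [set i in B | v.2 i \in T]) :
  (forall i j : 'I_n, i \in T -> j \notin T -> (i < j)%N) ->
  h \in parabolic p T ->
  undisturbed B (v * h)%g =
  [&& undisturbed B1 (v * h)%g, undisturbed (B :\: B1) v &
      [forall i in B1, forall j in B :\: B1, (i < j)%N]].
Proof.
move=> lowT /parabolicP hT.
have hperm i : (h.2 i \in T) = (i \in T).
  have [iT|/[dup] /negbTE iT /hT[_ ->//]] := boolP (i \in T).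
  by apply: contraT => /[dup] hiT /hT[_ /perm_inj hi]; rewrite hi iT in hiT.
have B1B i : i \in B1 -> i \in B by rewrite inE => /andP[].
have B1T i : i \in B1 -> v.2 i \in T by rewrite inE => /andP[].
have B2B i : i \in B :\: B1 -> i \in B by rewrite inE => /andP[].
have B2T i : i \in B :\: B1 -> v.2 i \notin T.
  by rewrite !inE => /andP[h' iB]; rewrite iB in h'.
have B12 i : i \in B -> (i \in B1) || (i \in B :\: B1).
  by rewrite !inE => iB; rewrite iB; case: (_ \in T).
have E1 i : i \in B :\: B1 -> (v * h)%g.1 i = v.1 i.
  by move=> /B2T/hT[h1 _]; rewrite wreathM1 h1 addr0.
have E2 i : i \in B :\: B1 -> (v * h)%g.2 i = v.2 i.
  by move=> /B2T/hT[_ h2]; rewrite wreathM2 h2.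
have lt12 i j : i \in B1 -> j \in B :\: B1 -> ((v * h)%g.2 i < (v * h)%g.2 j)%N.
  by move=> /B1T iT /[dup] /E2 -> /B2T jT; apply: lowT => //; rewrite wreathM2 hperm.
apply/undisturbedP/and3P => [[u1 u2]|].
  split.
  - by apply/undisturbedP; split=> [i /B1B|i j /B1B iB /B1B jB]; [exact: u1|exact: u2].
  - apply/undisturbedP; split=> [i iB|i j iB jB ij].
      by rewrite -E1 // u1 // B2B.
    by rewrite -!E2 // u2 // B2B.
  apply/forall_inP=> i iB; apply/forall_inP=> j jB; rewrite ltnNge; apply/negP.
  rewrite leq_eqVlt => /orP[/eqP/val_inj ij|ji].
    by move: jB; rewrite ij inE iB.
  by have := u2 j i (B2B _ jB) (B1B _ iB) ji; rewrite ltnNge (ltnW (lt12 _ _ iB jB)).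
case=> /undisturbedP[u1 u2] /undisturbedP[w1 w2] /forall_inP ord; split.
  by move=> i /B12/orP[/u1//|iB]; rewrite E1 // w1.
move=> i j /B12/orP[iB|iB] /B12/orP[jB|jB] ij.
- exact: u2.
- exact: lt12.
- by have /forall_inP/(_ _ iB) := ord _ jB; rewrite ltnNge ltnW.
- by rewrite !E2 //; exact: w2.
Qed.

Lemma card_block_average T B v (B1 := [set i in B | v.2 i \in T]) :
  (forall i j : 'I_n, i \in T -> j \notin T -> (i < j)%N) ->
  (#|[set h in parabolic p T | undisturbed B (v * h)%g]| * #|parabolic p B1| =
   #|parabolic p T| * (undisturbed (B :\: B1) v &&
      [forall i in B1, forall j in B :\: B1, (i < j)%N]))%N.
Proof.
move=> lowT; set b := _ && _.
have -> : [set h in parabolic p T | undisturbed B (v * h)%g] =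
    [set h in parabolic p T | undisturbed B1 (v * h)%g && b].
  apply/setP=> h; rewrite [LHS]finset.in_set [RHS]finset.in_set.
  have [hT|//] := boolP (h \in parabolic p T).
  by rewrite !andTb (undisturbed_block _ _ lowT hT).
case: b => /=; last first.
  rewrite muln0 (_ : [set h in _ | _] = finset.set0) ?cards0 //.
  by apply/setP=> h; rewrite !inE !andbF.
rewrite muln1 -(@card_undisturbed_block T B1 v) //.
  by congr (_ * _)%N; apply: eq_card => h; rewrite !inE andbT.
by move=> i; rewrite inE => /andP[].
Qed.

End BlockAverage.

(** * Undoing the insertion of the removed block *)
Section Insertion.
Local Open Scope set_scope.
Variables n p : nat.
Implicit Types (B C T : {set 'I_n}) (x y v w g h : wreath n p).

Lemma insertion_mem m (A : {set 'I_n}) i : #|A| = m ->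
  (insertion A i \in A) = (i < m)%N.
Proof.
move=> Am; rewrite permE /insertion_fun nth_cat -cardE Am.
case: ltnP => im; first by rewrite -mem_enum mem_nth // -cardE Am.
apply/negbTE; rewrite -finset.in_setC -mem_enum mem_nth // -cardE.
by rewrite ltn_subLR // -Am cardsC card_ord.
Qed.

Lemma insertion_mono m (A : {set 'I_n}) (i j : 'I_n) : #|A| = m -> (m <= i < j)%N ->
  (insertion A i < insertion A j)%N.
Proof.
move=> Am /andP[mi ij]; have mj := leq_trans mi (ltnW ij).
have jA : (j - m < size (enum (~: A)))%N.
  by rewrite -cardE ltn_subLR // -Am cardsC card_ord.
rewrite !permE /insertion_fun !nth_cat -cardE Am (ltnNge i) mi (ltnNge j) mj /=.
rewrite (set_nth_default j i); last by apply: leq_ltn_trans jA; rewrite leq_sub2r // ltnW.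
have := sorted_enum (~: A); rewrite sorted_map => sA.
apply: (sorted_ltn_nth (fun _ _ _ => @ltn_trans _ _ _) _ sA) => //.
- by rewrite inE; apply: leq_ltn_trans jA; rewrite leq_sub2r // ltnW.
- by rewrite ltn_sub2r // (leq_ltn_trans mi).
Qed.

Definition insertion_deck (A : {set 'I_n}) : wreath n p := ([ffun=> 0], insertion A).

Lemma mulV_insertion_deck1 x A i : (x * (insertion_deck A)^-1)%g.1 i = x.1 i.
Proof. by rewrite wreathM1 wreathV1 ffunE oppr0 addr0. Qed.

Lemma mulV_insertion_deck2 x A i :
  (x * (insertion_deck A)^-1)%g.2 i = (insertion A)^-1%g (x.2 i).
Proof. by rewrite wreathM2. Qed.

Lemma mulV_insertion_top m x (A : {set 'I_n}) i : #|A| = m ->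
  ((x * (insertion_deck A)^-1)%g.2 i \in top_block n m) = (x.2 i \in A).
Proof.
by move=> Am; rewrite mulV_insertion_deck2 inE -(insertion_mem _ Am) permKV.
Qed.

Lemma undisturbed_mulV_insertion (A : {set 'I_n}) C x : {in C, forall i, x.2 i \notin A} ->
  undisturbed C (x * (insertion_deck A)^-1)%g = undisturbed C x.
Proof.
move=> CA.
have Ci i : i \in C -> (#|A| <= (insertion A)^-1%g (x.2 i))%N.
  by move=> /CA; rewrite leqNgt -(insertion_mem _ (erefl #|A|)) permKV.
have mono i j : i \in C -> j \in C ->
    ((insertion A)^-1%g (x.2 i) < (insertion A)^-1%g (x.2 j))%N ->
    (x.2 i < x.2 j)%N.
  move=> iC jC ij; rewrite -[x.2 i](permKV (insertion A)) -[x.2 j](permKV (insertion A)).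
  by apply: (insertion_mono (erefl #|A|)); rewrite Ci.
apply/undisturbedP/undisturbedP => -[u1 u2]; split=> [i iC|i j iC jC ij].
- by rewrite -(u1 _ iC) mulV_insertion_deck1.
- by apply: mono => //; rewrite -!mulV_insertion_deck2 u2.
- by rewrite mulV_insertion_deck1 u1.
rewrite !mulV_insertion_deck2 ltnNge leq_eqVlt; apply/negP => /orP[/eqP/val_inj|].
  by move=> /perm_inj/perm_inj ji; rewrite ji ltnn in ij.
by move=> /mono => /(_ jC iC); rewrite ltnNge (ltnW (u2 _ _ iC jC ij)).
Qed.

(** The color and permutation of a choice form an element of the parabolic
subgroup of the top block, so a step is a uniform element of this subgroup
followed by a uniform insertion. *)
Lemma shuffle_choices_prod m : shuffle_choices n p m =
  finset.setX (parabolic p (top_block n m) : {set wreath n p})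
    [set A : {set 'I_n} | #|A| == m].
Proof.
apply/setP => -[w A]; rewrite parabolicE finset.in_setX !inE /=.
by rewrite andbA.
Qed.

Lemma card_shuffle_choices m :
  #|shuffle_choices n p m| = (#|parabolic p (top_block n m)| * 'C(n, m))%N.
Proof. by rewrite shuffle_choices_prod cardsX card_draws card_ord. Qed.

(** Summing over the random choices of the step instead of over the previous
deck: the previous deck is recovered from [x] by undoing the insertion, then
the rearrangement of the top block, whose inverse runs over the same subgroup.
*)
Lemma convolution_shuffle (R : realType) m (f : wreath n p -> R) x :
  convolution f (shuffle_law m R) x =
  (\sum_(A : {set 'I_n} | #|A| == m) \sum_(h in parabolic p (top_block n m))
     f (x * (insertion_deck A)^-1 * h)%g) / #|shuffle_choices n p m|%:R.
Proof.
rewrite /convolution /shuffle_law.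
under eq_bigr do rewrite mulrA.
rewrite -mulr_suml; congr (_ / _).
transitivity (\sum_(w in shuffle_choices n p m) f (x * (shuffle_step w)^-1)%g).
  transitivity (\sum_(y : wreath n p) \sum_(w in shuffle_choices n p m)
     f y * (shuffle_step w == (y^-1 * x)%g)%:R).
    apply: eq_bigr => y _; rewrite -mulr_sumr; congr (_ * _).
    rewrite -sum1dep_card natr_sum big_mkcondr.
    by apply: eq_bigr => w _; case: eqP.
  rewrite exchange_big; apply: eq_bigr => w _ /=.
  rewrite (bigD1 (x * (shuffle_step w)^-1)%g) //=.
  rewrite invMg invgK -mulgA mulVg mulg1 eqxx mulr1 big1 ?addr0 // => y yx.
  case: eqP => [wE|]; last by rewrite mulr0.
  by case/eqP: yx; rewrite wE invMg invgK mulgA mulgV mul1g.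
rewrite exchange_big /= shuffle_choices_prod.
rewrite (reindex_inj invg_inj) /=.
rewrite pair_big /=; apply: eq_big => [[h A]|[h A] _] /=.
  by rewrite finset.in_setX groupV !inE.
pose h' : wreath n p := h.
suff -> : shuffle_step (h, A) = (h' * insertion_deck A)%g by rewrite invMg mulgA.
by congr pair; apply/ffunP=> i; rewrite !ffunE addr0.
Qed.

End Insertion.

(** * The last labels and their initial segments *)
Section BottomCards.
Local Open Scope set_scope.
Variables n : nat.
Implicit Types (B C T : {set 'I_n}).

Lemma card_ord_itv (l r : nat) : (r <= n)%N ->
  #|[set i : 'I_n | (l <= i < r)%N]| = (r - l)%N.
Proof.
move=> rn; rewrite -sum1dep_card -(big_mkord (fun i => (l <= i < r)%N) (fun=> 1%N)).
rewrite [LHS](_ : _ = \sum_(l <= i < r) 1)%N; last first.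
  rewrite (big_nat_widen _ _ _ _ _ rn) (big_nat_widenl l 0) //.
  by apply: eq_bigl => i; rewrite andbC.
by rewrite sum_nat_const_nat muln1.
Qed.

Definition bottom_cards j : {set 'I_n} := [set i : 'I_n | (n - j <= i)%N].

Definition bottom_head j a : {set 'I_n} := [set i : 'I_n | (n - j <= i < n - j + a)%N].

Lemma card_bottom j : (j <= n)%N -> #|bottom_cards j| = j.
Proof.
move=> jn; rewrite -[RHS](subKn jn) -(card_ord_itv (n - j) (leqnn n)).
by apply: eq_card => i; rewrite !inE ltn_ord andbT.
Qed.

Lemma card_bottom_head j a : (a <= j <= n)%N -> #|bottom_head j a| = a.
Proof.
by move=> ajn; rewrite card_ord_itv; lia.
Qed.

(** A subset of the last [j] labels precedes its complement there iff it is an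
initial segment: this is the order in which untouched cards reach the top
block. *)
Lemma bottom_headP j (C : {set 'I_n}) : (j <= n)%N -> C \subset bottom_cards j ->
  [forall i in C, forall i' in bottom_cards j :\: C, (i < i')%N] =
  (C == bottom_head j #|C|).
Proof.
move=> jn CB; have Cj : (#|C| <= j)%N.
  by rewrite -[leqRHS](card_bottom jn) subset_leq_card.
apply/forall_inP/eqP => [ord|CE i iC]; last first.
  apply/forall_inP=> i'; rewrite CE in iC *; move: iC; rewrite !inE; lia.
apply/eqP; rewrite eqEcard card_bottom_head ?Cj // leqnn andbT.
apply/fintype.subsetP=> i iC; have := fintype.subsetP CB _ iC; rewrite !inE => ji.
rewrite ji /=.
have sub : [set i' : 'I_n | (n - j <= i' < i.+1)%N] \subset C.
  apply/fintype.subsetP => i'; rewrite inE => /andP[ji' i'i].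
  apply: contraT => i'C.
  have /forall_inP/(_ i') := ord _ iC.
  by rewrite !inE i'C ji' ltnNge -ltnS i'i => /(_ isT).
by have := subset_leq_card sub; rewrite card_ord_itv // leq_subLR.
Qed.

Lemma bottom_diff_head j a : (a <= j <= n)%N ->
  bottom_cards j :\: bottom_head j a = bottom_cards (j - a).
Proof. by move=> ajn; apply/setP => i; rewrite !inE; lia. Qed.

(** Off [B] the set [A] is an arbitrary subset of [~: B] of size [m - #|S|]. *)
Lemma card_draws_inter (B S : {set 'I_n}) m : S \subset B ->
  #|[set A : {set 'I_n} | (#|A| == m) && (B :&: A == S)]| =
  (if #|S| <= m then 'C(n - #|B|, m - #|S|) else 0)%N.
Proof.
move=> SB; case: leqP => [Sm|mS]; last first.
  apply/eqP; rewrite cards_eq0; apply/eqP/setP=> A; rewrite !inE.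
  apply/negbTE; apply: contraTN mS => /andP[/eqP <- /eqP <-].
  by rewrite -leqNgt subset_leq_card // subsetIr.
have <- : #|~: B| = (n - #|B|)%N by rewrite cardsCs finset.setCK card_ord.
rewrite -cards_draws -[RHS](@card_in_imset _ _ (fun D => S :|: D)).
  apply: eq_card => A; rewrite finset.in_set; apply/andP/imsetP => [[/eqP Am /eqP BA]|[D]].
    exists (A :\: B); last by rewrite -BA finset.setIC finset.setID.
    rewrite inE finset.setDE subsetIr /=.
    by rewrite -finset.setDE cardsD finset.setIC BA Am.
  rewrite inE => /andP[DB /eqP Dm] ->.
  have BD : B :&: D = finset.set0.
    by apply/eqP; rewrite finset.setIC finset.setI_eq0 finset.disjoints_subset.
  rewrite finset.setIUr BD finset.setU0 (finset.setIidPr SB); split=> //.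
  rewrite cardsU (_ : S :&: D = finset.set0) ?cards0 ?subn0 ?Dm ?subnKC //.
  by apply/eqP; rewrite -finset.subset0 -BD finset.setSI.
move=> D D'; rewrite !inE => /andP[DB _] /andP[D'B _] /setP SD.
apply/setP => i; have := SD i; rewrite !inE.
have [iS _|//] := boolP (i \in S); have iB := fintype.subsetP SB _ iS.
have no (D0 : {set 'I_n}) : D0 \subset ~: B -> (i \in D0) = false.
  move=> /fintype.subsetP/(_ i) D0B; apply: contraTF iB => /D0B; rewrite inE.
  exact.
by rewrite !no.
Qed.

End BottomCards.

(** * One step of the shuffle *)

(** Probability that [a] of the [j] untouched cards are among the [m] cards
that the next step removes: in the inverse picture, that [m] random positions
meet a given set of [j] positions in [a] points. *)
Definition hypergeom (R : realType) (n m j a : nat) : R :=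
  ('C(j, a) * 'C(n - j, m - a))%:R / 'C(n, m)%:R.

Section OneStep.
Local Open Scope set_scope.
Variables n p : nat.
Hypothesis p_gt0 : (0 < p)%N.
Implicit Types (B C T : {set 'I_n}) (x y v w g h : wreath n p).
Variable R : realType.

Definition bottom_law j x : R :=
  (undisturbed (bottom_cards n j) x)%:R * (j`! * p ^ j)%:R / (n`! * p ^ n)%:R.

Lemma parabolic_gt0 C : (0 < #|parabolic p C|)%N.
Proof. by rewrite card_parabolic // muln_gt0 fact_gt0 expn_gt0 p_gt0. Qed.

(** For a fixed insertion set [A] the cards of the last [j] labels that were
moved are those with final position in [A]. Rearrangements of the top block put
them in order with color 0 once in [a! p^a] times, where [a] is their number,
and they must be the first [a] of the [j] labels; at most one term of the sum
is nonzero. *)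
Lemma sum_block_undisturbed m j x (A : {set 'I_n}) : (j <= n)%N -> #|A| = m ->
  \sum_(h in parabolic p (top_block n m))
    (undisturbed (bottom_cards n j) (x * (insertion_deck p A)^-1 * h)%g)%:R =
  \sum_(a < m.+1 | (a <= j)%N) #|parabolic p (top_block n m)|%:R /
    (a`! * p ^ a)%:R * ((bottom_cards n j :&: x.2 @^-1: A == bottom_head n j a) &&
      undisturbed (bottom_cards n (j - a)) x)%:R :> R.
Proof.
move=> jn Am; set T := top_block n m; set v := (x * _)%g.
have lowT (i i' : 'I_n) : i \in T -> i' \notin T -> (i < i')%N.
  by rewrite !inE -leqNgt; exact: leq_trans.
pose C := bottom_cards n j :&: x.2 @^-1: A.
have CE : [set i in bottom_cards n j | v.2 i \in T] = C.
  apply/setP=> i; rewrite [LHS]finset.in_set (mulV_insertion_top _ _ Am).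
  by rewrite finset.in_setI (finset.in_set (fun i => x.2 i \in A)).
have Cj : (#|C| <= j)%N by rewrite -[leqRHS](card_bottom jn) subset_leq_card // subsetIl.
have Cm : (#|C| < m.+1)%N.
  rewrite ltnS -Am (leq_trans (subset_leq_card (subsetIr _ _))) //.
  by rewrite on_card_preimset //; exact: onW_bij (Bijective (permK _) (permKV _)).
have := card_block_average (bottom_cards n j) v lowT; rewrite CE.
rewrite bottom_headP ?subsetIl // undisturbed_mulV_insertion; last first.
  by move=> i; rewrite !inE => /andP[h iB]; rewrite iB in h.
move=> N; rewrite [RHS](bigD1 (Ordinal Cm)) //= [X in _ + X]big1 ?addr0; last first.
  move=> a /andP[aj aC]; case: eqP => [Ca|_]; last by rewrite mulr0.
  case/eqP: aC; apply: val_inj => /=.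
  by rewrite -/C in Ca; rewrite Ca card_bottom_head // aj.
have E : (undisturbed (bottom_cards n j :\: C) x && (C == bottom_head n j #|C|)) =
   ((C == bottom_head n j #|C|) && undisturbed (bottom_cards n (j - #|C|)) x).
  rewrite andbC; case: eqP => //= CH.
  by rewrite {1}CH bottom_diff_head // Cj.
rewrite -card_parabolic //.
move: N => /(congr1 (fun k => k%:R : R)); rewrite !natrM E => N.
rewrite mulrAC -/C -N mulfK ?pnatr_eq0 -?lt0n ?parabolic_gt0 //.
rewrite -sum1dep_card natr_sum big_mkcondr.
by apply: eq_bigr => h _; case: ifP.
Qed.

(** After summing [sum_block_undisturbed] over [A], the sets [A] that meet the
positions of the last [j] labels in those of the first [a] of them are counted
by [card_draws_inter]; the factorials recombine into [hypergeom]. *)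
Lemma convolution_bottom_law m j x : (j <= n)%N -> (m <= n)%N ->
  convolution (bottom_law j) (shuffle_law m R) x =
  \sum_(a < m.+1 | (a <= j)%N) hypergeom R n m j a * bottom_law (j - a) x.
Proof.
move=> jn mn; rewrite convolution_shuffle /bottom_law.
under eq_bigr do under eq_bigr do rewrite -mulrA.
under eq_bigr => A /eqP Am do rewrite -mulr_suml sum_block_undisturbed //.
rewrite -mulr_suml exchange_big /= !mulr_suml; apply: eq_bigr => a aj.
have am : (a <= m)%N by rewrite -ltnS.
rewrite -mulr_sumr (reindex_inj (imset_inj (@perm_inj _ x.2))) /=.
have -> : \sum_(A : {set 'I_n} | #|x.2 @: A| == m)
    ((bottom_cards n j :&: x.2 @^-1: (x.2 @: A) == bottom_head n j a) &&
       undisturbed (bottom_cards n (j - a)) x)%:R =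
   (undisturbed (bottom_cards n (j - a)) x)%:R * 'C(n - j, m - a)%:R :> R.
  transitivity ((undisturbed (bottom_cards n (j - a)) x)%:R *
    \sum_(A : {set 'I_n} |
      (#|A| == m) && (bottom_cards n j :&: A == bottom_head n j a)) 1 : R).
    rewrite mulr_sumr [RHS]big_mkcondr /=; apply: eq_big => A.
      by rewrite card_imset //; exact: perm_inj.
    move=> _; have -> : x.2 @^-1: (x.2 @: A) = A.
      by apply/setP=> i; rewrite inE mem_imset //; exact: perm_inj.
    by case: (_ == _); rewrite ?mulr1.
  congr (_ * _); rewrite sumr_const -cardsE card_draws_inter.
    by rewrite card_bottom_head ?aj ?jn // am card_bottom.
  by apply/fintype.subsetP=> i; rewrite !inE => /andP[].
rewrite card_shuffle_choices /hypergeom.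
have jE : j`! = ('C(j, a) * (a`! * (j - a)`!))%N by rewrite bin_fact.
have pE : (p ^ j = p ^ a * p ^ (j - a))%N by rewrite -expnD subnKC.
rewrite jE pE !natrM.
have h1 : #|parabolic p (top_block n m)|%:R != 0 :> R.
  by rewrite pnatr_eq0 -lt0n parabolic_gt0.
have h2 : a`!%:R != 0 :> R by rewrite pnatr_eq0 -lt0n fact_gt0.
have h3 : n`!%:R != 0 :> R by rewrite pnatr_eq0 -lt0n fact_gt0.
have h4 k : (p ^ k)%:R != 0 :> R by rewrite pnatr_eq0 -lt0n expn_gt0 p_gt0.
have h5 : 'C(n, m)%:R != 0 :> R by rewrite pnatr_eq0 -lt0n bin_gt0.
have h4a := h4 a; have h4n := h4 n.
field.
by rewrite h1 h2 h3 h4a h4n h5.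
Qed.

End OneStep.

(** * The number of untouched cards *)
Section Untouched.
Variable R : realType.
Implicit Types (n m k j a r i : nat).

(** The Markov chain with start [n] and transition probabilities [hypergeom R n
m j a] from [j] to [j - a]. *)
Fixpoint untouched_law n m k : nat -> R :=
  if k is k'.+1 then fun i =>
    \sum_(j < n.+1) \sum_(a < m.+1 | (a + i)%N == j)
      untouched_law n m k' j * hypergeom R n m j a
  else fun i => (i == n)%:R.

Lemma untouched_law_ge0 n m k i : 0 <= untouched_law n m k i.
Proof.
elim: k i => [|k IH] i /=; first exact: ler0n.
apply: sumr_ge0 => j _; apply: sumr_ge0 => a _.
by rewrite mulr_ge0 // /hypergeom divr_ge0 ?ler0n.
Qed.

(** The transition operator acting on test functions; it serves both for the
moments and for the mixture of the laws [bottom_law]. *)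
Lemma sum_untouched_lawS n m k (G : nat -> R) :
  \sum_(i < n.+1) untouched_law n m k.+1 i * G i =
  \sum_(j < n.+1) untouched_law n m k j *
     \sum_(a < m.+1 | (a <= j)%N) hypergeom R n m j a * G (j - a)%N.
Proof.
under eq_bigr => i _ do rewrite mulr_suml.
rewrite exchange_big /=; apply: eq_bigr => j _.
under eq_bigr => i _ do rewrite mulr_suml big_mkcond /=.
rewrite exchange_big /= mulr_sumr [RHS]big_mkcond /=; apply: eq_bigr => a _.
rewrite -big_mkcond /=; case: leqP => aj.
  have jan : (j - a < n.+1)%N by rewrite (leq_ltn_trans (leq_subr _ _)).
  rewrite (big_pred1 (Ordinal jan)) /= ?mulrA // => i /=.
  by rewrite -val_eqE /=; lia.
by rewrite big_pred0 // => i; lia.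
Qed.

Lemma mul_bin_sub j a r : ('C(j, a) * 'C(j - a, r) = 'C(j, r) * 'C(j - r, a))%N.
Proof.
have z b c : (j < b + c)%N -> ('C(j, b) * 'C(j - b, c) = 0)%N.
  move=> jbc; have [bj|jb] := leqP b j; last by rewrite bin_small.
  by rewrite [X in (_ * X)%N]bin_small ?muln0 //; lia.
have [arj|jar] := leqP (a + r) j; last by rewrite !z // addnC.
have aj : (a <= j)%N by lia. have rj : (r <= j)%N by lia.
have raj : (r <= j - a)%N by lia. have arj' : (a <= j - r)%N by lia.
apply/eqP; rewrite -(@eqn_pmul2r (a`! * r`! * (j - a - r)`!)) ?muln_gt0 ?fact_gt0 //.
apply/eqP; transitivity j`!.
  by rewrite -(bin_fact aj) -(bin_fact raj); ring.
rewrite -(bin_fact rj) -(bin_fact arj') (_ : j - r - a = j - a - r)%N; last by lia.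
by ring.
Qed.

(** Binomial coefficients in [j] are eigenfunctions of the transition operator
of the chain: after [mul_bin_sub] the sum is Vandermonde's. *)
Lemma hypergeom_moment n m j r : (j <= n)%N ->
  \sum_(a < m.+1 | (a <= j)%N) hypergeom R n m j a * 'C(j - a, r)%:R =
  'C(j, r)%:R * ('C(n - r, m)%:R / 'C(n, m)%:R).
Proof.
move=> jn; have [rj|jr] := leqP r j; last first.
  rewrite (bin_small jr) mul0r big1 // => a _.
  by rewrite [X in _ * X%:R]bin_small ?mulr0 //; lia.
have -> : (n - r = (j - r) + (n - j))%N by lia.
rewrite -binomial.Vandermonde natr_sum mulr_suml mulr_sumr big_mkcond /=.
apply: eq_bigr => a _; case: ifPn => [aj|]; last first.
  by rewrite -ltnNge => ja; rewrite [X in (X * _)%N]bin_small ?mul0n ?mul0r ?mulr0 //; lia.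
rewrite /hypergeom !natrM !mulrA [_ / _ * 'C(_ - a, _)%:R]mulrAC; congr (_ / _).
rewrite mulrAC -natrM mul_bin_sub natrM; ring.
Qed.

Lemma untouched_law_moment n m k r :
  \sum_(j < n.+1) untouched_law n m k j * 'C(j, r)%:R =
  'C(n, r)%:R * ('C(n - r, m)%:R / 'C(n, m)%:R) ^+ k.
Proof.
elim: k => [|k IH].
  rewrite expr0 mulr1 (bigD1 ord_max) //= eqxx mul1r big1 ?addr0 // => i ni.
  by rewrite (_ : _ == _ = false) ?mul0r //; apply/negbTE.
rewrite (sum_untouched_lawS n m k (fun j => 'C(j, r)%:R)).
rewrite exprSr mulrA -IH mulr_suml; apply: eq_bigr => j _.
by rewrite hypergeom_moment ?mulrA // -ltnS.
Qed.

(** Expand ['X^i = (1 + ('X - 1))^i] in powers of ['X - 1] and compare the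
coefficients of ['X^j]. *)
Lemma binomial_inversion n i j : (i <= n)%N ->
  \sum_(r < n.+1) (-1) ^+ (r - j) *+ 'C(r, j) *+ 'C(i, r) = (i == j)%:R :> R.
Proof.
move=> i_n.
have coefXB1 r : (('X - 1) ^+ r : {poly R})`_j = (-1) ^+ (r - j) *+ 'C(r, j).
  rewrite addrC exprDn coef_sum.
  have term (s : 'I_r.+1) : ((-1) ^+ (r - s) * 'X^s *+ 'C(r, s) : {poly R})`_j =
      (-1) ^+ (r - s) *+ 'C(r, s) * (j == s)%:R.
    have -> : (-1) ^+ (r - s) = ((-1) ^+ (r - s))%:P :> {poly R}.
      by rewrite rmorphXn rmorphN1.
    by rewrite coefMn coefCM coefXn mulrnAl.
  under eq_bigr do rewrite term.
  have [jr|rj] := leqP j r; last first.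
    rewrite bin_small // big1 // => s _; rewrite (_ : (j == s) = false) ?mulr0 //.
    by have := ltn_ord s; lia.
  have jr' : (j < r.+1)%N by [].
  rewrite (bigD1 (Ordinal jr')) //= eqxx mulr1 big1 ?addr0 // => s.
  by rewrite -val_eqE /= eq_sym => /negbTE ->; rewrite mulr0.
have : ((1 + ('X - 1)) ^+ i : {poly R})`_j = (i == j)%:R.
  by rewrite addrC subrK coefXn eq_sym.
rewrite exprDn coef_sum => <-.
rewrite (big_ord_widen n.+1
  (fun r => (1 ^+ (i - r) * ('X - 1) ^+ r *+ 'C(i, r) : {poly R})`_j)) //.
rewrite [RHS]big_mkcond /=; apply: eq_bigr => r _.
rewrite expr1n mul1r coefMn coefXB1; case: ltnP => //.
by move=> ir; rewrite [X in _ *+ X]bin_small.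
Qed.

Lemma untouched_law_inversion n m k j :
  (j <= n)%N ->
  untouched_law n m k j = \sum_(r < n.+1) (-1) ^+ (r - j) *+ 'C(r, j) *
     ('C(n, r)%:R * ('C(n - r, m)%:R / 'C(n, m)%:R) ^+ k).
Proof.
move=> jn.
under eq_bigr => r _ do rewrite -untouched_law_moment mulr_sumr.
rewrite exchange_big /=.
transitivity (\sum_(i < n.+1) untouched_law n m k i * (val i == j)%:R).
  have jn' : (j < n.+1)%N by [].
  rewrite (bigD1 (Ordinal jn')) //= eqxx mulr1 big1 ?addr0 // => i.
  by rewrite -val_eqE /= => /negbTE ->; rewrite mulr0.
apply: eq_bigr => i _.
have i_n : (i <= n)%N by rewrite -ltnS.
rewrite -(binomial_inversion j i_n) mulr_sumr; apply: eq_bigr => r _.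
by rewrite -[_ *+ 'C(i, r)]mulr_natr; ring.
Qed.

(** A probability [P j] is at most the binomial moment of order [j], in which
it has the coefficient 1. *)
Lemma untouched_law_fact_le n m k j : (j <= n)%N ->
  untouched_law n m k j * j`!%:R <=
  j`!%:R * ('C(n, j)%:R * ('C(n - j, m)%:R / 'C(n, m)%:R) ^+ k).
Proof.
move=> jn; rewrite mulrC ler_wpM2l // -untouched_law_moment.
have jn' : (j < n.+1)%N by [].
rewrite (bigD1 (Ordinal jn')) //= binn mulr1 lerDl sumr_ge0 // => i _.
by rewrite mulr_ge0 // untouched_law_ge0.
Qed.

Variables (n p : nat).
Hypothesis p_gt0 : (0 < p)%N.

Lemma undisturbed_all (x : wreath n p) :
  undisturbed (bottom_cards n n) x = (x == 1%g).
Proof.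
have B (i : 'I_n) : i \in bottom_cards n n by rewrite inE subnn.
apply/undisturbedP/eqP => [[u1 u2]|->]; last first.
  by split=> [i _|i j _ _]; rewrite ?ffunE ?perm1.
rewrite [x]surjective_pairing; congr pair; first by apply/ffunP=> i; rewrite u1 // ffunE.
apply: (@sorting_perm_unique n (bottom_cards n n) 1%g).
- by apply/perm_onP=> i; rewrite B.
- by apply/perm_onP=> i; rewrite B.
- by move=> i j Bi Bj ij; rewrite !perm1 u2.
by move=> i j Bi Bj ij; rewrite !perm1.
Qed.

(** The start is the case [j = n], as the identity is the only deck with all
cards undisturbed. *)
Lemma shuffle_pow_law m k (x : wreath n p) : (m <= n)%N ->
  convolution_pow (shuffle_law m R) k x =
  \sum_(j < n.+1) untouched_law n m k j * bottom_law R j x.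
Proof.
move=> mn; elim: k x => [|k IH] x.
  rewrite (bigD1 ord_max) //= eqxx mul1r big1 ?addr0 => [|i ni]; last first.
    by rewrite (_ : _ == _ = false) ?mul0r //; apply/negbTE.
  rewrite /bottom_law undisturbed_all -mulrA divff ?mulr1 //.
  by rewrite pnatr_eq0 -lt0n muln_gt0 fact_gt0 expn_gt0 p_gt0.
rewrite (sum_untouched_lawS n m k (fun j => bottom_law R j x)).
rewrite /convolution_pow iterS -/(convolution_pow _ _) {1}/convolution.
under eq_bigr => y _ do rewrite IH mulr_suml.
rewrite exchange_big /=; apply: eq_bigr => j _.
under eq_bigr => y _ do rewrite -mulrA.
rewrite -mulr_sumr -convolution_bottom_law // -ltnS //.
Qed.

End Untouched.

(** * The level of a deck *)
Section Levels.
Local Open Scope set_scope.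
Variables (R : realType) (n p : nat).
Hypothesis p_gt0 : (0 < p)%N.
Implicit Types (x : wreath n p) (j l : nat) (P : nat -> R) (Phi : R -> R).

Definition level x : nat := \max_(j < n.+1 | undisturbed (bottom_cards n j) x) j.

Lemma undisturbed_sub (B C : {set 'I_n}) x :
  B \subset C -> undisturbed C x -> undisturbed B x.
Proof.
move=> /fintype.subsetP BC /undisturbedP[u1 u2]; apply/undisturbedP.
by split=> [i /BC|i j /BC iC /BC jC]; [exact: u1|exact: u2].
Qed.

Lemma level_le x : (level x <= n)%N.
Proof. by apply/bigmax_leqP => j _; rewrite -ltnS. Qed.

Lemma undisturbed_level x j : (j <= n)%N ->
  undisturbed (bottom_cards n j) x = (j <= level x)%N.
Proof.
move=> jn; apply/idP/idP => [uj|].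
  have jn' : (j < n.+1)%N by [].
  exact: (bigop.bigmax_sup (Ordinal jn')).
have u0 : undisturbed (bottom_cards n (@ord0 n)) x.
  by apply/undisturbedP; split=> [i|i i']; rewrite inE subn0 leqNgt ltn_ord.
rewrite /level (bigop.bigmax_eq_arg (@ord0 n)) //; case: arg_maxnP => //= j0 uj0 _ jj0.
apply: undisturbed_sub uj0.
by apply/fintype.subsetP => i; rewrite !inE; apply: leq_trans; rewrite leq_sub2l.
Qed.

(** For [l <= n], the fraction of the decks that have level at least [l], see
[card_level_ge]. *)
Definition tail_coef l : R := (l`!%:R * p%:R ^+ l)^-1.

Lemma fact_exp_neq0 l : l`!%:R * p%:R ^+ l != 0 :> R.
Proof.
by rewrite mulf_neq0 ?expf_neq0 // pnatr_eq0 -lt0n ?fact_gt0.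
Qed.

Lemma card_wreathR : #|{: wreath n p}|%:R = n`!%:R * p%:R ^+ n :> R.
Proof. by rewrite card_wreath // natrM natrX. Qed.

Lemma unif_lawE x : unif_law R x = tail_coef n.
Proof. by rewrite /unif_law card_wreathR. Qed.

Lemma card_level_ge l : (l <= n)%N ->
  #|[set x | (l <= level x)%N]|%:R * tail_coef n = tail_coef l.
Proof.
move=> ln.
have -> : [set x | (l <= level x)%N] =
    [set x : wreath n p | undisturbed (bottom_cards n l) x].
  by apply/setP=> x; rewrite !inE undisturbed_level.
have := card_undisturbed p (bottom_cards n l).
rewrite card_parabolic // card_bottom // => /(congr1 (fun k => k%:R : R)).
rewrite card_wreathR !natrM natrX => E.
rewrite /tail_coef -E invfM mulrA mulfV ?div1r ?mul1r //.
by apply: contraNneq (fact_exp_neq0 n) => u0; rewrite -E u0 mul0r.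
Qed.

(** Uniform probability of the level [l], see [card_level]; at the top level
[n] there is no higher level to subtract. *)
Definition level_law l : R := if l == n then tail_coef n else a_coef R p l.

Lemma card_level l : (l <= n)%N ->
  #|[set x | level x == l]|%:R * tail_coef n = level_law l.
Proof.
rewrite leq_eqVlt /level_law => /orP[/eqP ->|ln].
  rewrite eqxx -[RHS](card_level_ge (leqnn n)); congr (_%:R * _).
  by apply: eq_card => x; rewrite !inE eqn_leq level_le.
rewrite (ltn_eqF ln) /a_coef -/(tail_coef l) -/(tail_coef l.+1).
rewrite -(card_level_ge (ltnW ln)) -(card_level_ge ln).
rewrite -mulrBl; congr (_ * _).
rewrite (_ : [set x | level x == l] =
  [set x | (l <= level x)%N] :\: [set x | (l < level x)%N]); last first.
  by apply/setP => x; rewrite !inE -leqNgt -eqn_leq.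
rewrite cardsD (finset.setIidPr _) ?natrB //.
  by apply: subset_leq_card; apply/fintype.subsetP => x; rewrite !inE => /ltnW.
by apply/fintype.subsetP => x; rewrite !inE => /ltnW.
Qed.

(** Density with respect to the uniform law, at decks of level [l], of the
mixture of the [bottom_law j] with weights [P j]: such a deck lies in the
support of [bottom_law j] iff [j <= l]. *)
Definition density P l : R := \sum_(j < l.+1) P j * (j`!%:R * p%:R ^+ j).

Lemma shuffle_pow_density m k x : (m <= n)%N ->
  convolution_pow (shuffle_law m R) k x / unif_law R x =
  density (untouched_law R n m k) (level x).
Proof.
move=> mn; rewrite shuffle_pow_law // unif_lawE /tail_coef invrK mulr_suml.
rewrite /density (big_ord_widen n.+1
  (fun j => untouched_law R n m k j * (j`!%:R * p%:R ^+ j))) ?ltnS ?level_le //.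
rewrite [RHS]big_mkcond /=; apply: eq_bigr => j _.
have jn : (j <= n)%N by rewrite -ltnS.
rewrite /bottom_law undisturbed_level // ltnS.
case: leqP => _; last by rewrite !mul0r mulr0 mul0r.
by rewrite mul1r !natrM !natrX -mulrA mulfVK // fact_exp_neq0.
Qed.

Lemma phi_div_level (M : wreath n p -> R) P Phi :
  (forall x, M x / unif_law R x = density P (level x)) ->
  phi_div Phi M (unif_law R) =
  \sum_(l < n.+1) level_law l * Phi (density P l).
Proof.
move=> ME; rewrite /phi_div.
under eq_bigr => x _ do rewrite ME unif_lawE.
have lev (x : wreath n p) : (level x < n.+1)%N by rewrite ltnS level_le.
rewrite (partition_big (fun x => Ordinal (lev x)) xpredT) //=.
apply: eq_bigr => l _; have ln : (l <= n)%N by rewrite -ltnS.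
rewrite -card_level // -sum1dep_card natr_sum !mulr_suml.
apply: eq_big => [x|x /eqP <-]; first by rewrite -val_eqE.
by rewrite mul1r.
Qed.

Lemma exists_level l : (l <= n)%N -> level_law l != 0 -> exists x, level x = l.
Proof.
move=> ln; rewrite -card_level // mulf_eq0 negb_or => /andP[+ _].
rewrite pnatr_eq0 -lt0n => /card_gt0P[x]; rewrite inE => /eqP; by exists x.
Qed.

(** The density is nondecreasing in the level, so it is smallest at the lowest
attained level. *)
Lemma sep_dist_level (M : wreath n p -> R) P l0 :
  (forall l, 0 <= P l) ->
  (forall x, M x / unif_law R x = density P (level x)) ->
  (forall x, l0 <= level x)%N -> (exists x, level x = l0) ->
  sep_dist M (unif_law R) = 1 - density P l0.
Proof.
move=> P0 ME l0min [x0 x0l]; rewrite /sep_dist.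
have mono x : density P l0 <= density P (level x).
  rewrite /density (big_ord_widen (level x).+1
    (fun j => P j * (j`!%:R * p%:R ^+ j))) ?ltnS //.
  rewrite big_mkcond /=; apply: ler_sum => j _; case: ifP => // _.
  by rewrite !mulr_ge0 // exprn_ge0.
apply/le_anti/andP; split.
  apply: (big_ind (fun y => y <= 1 - density P l0)).
  - by rewrite ME lerD2l lerN2.
  - by move=> a b al bl; rewrite ge_max al.
  - by move=> x _; rewrite ME lerD2l lerN2.
rewrite -x0l -ME; exact: le_bigmax.
Qed.

End Levels.

(** * Dominated convergence for series and elementary bounds *)
Section Analysis.
Variable R : realType.

Lemma near_eq_cvgn (f g : nat -> R) (a : R) :
  (\forall n \near \oo, f n = g n) -> f @ \oo --> a -> g @ \oo --> a.
Proof. by move=> fg; apply: cvg_trans; exact: near_eq_cvg. Qed.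

Lemma cvgn_sum (I : Type) (s : seq I) (F : I -> nat -> R) (a : I -> R) :
  (forall i, F i n @[n --> \oo] --> a i) ->
  \sum_(i <- s) F i n @[n --> \oo] --> \sum_(i <- s) a i.
Proof.
move=> Fa; apply: (@cvg_big _ _ +%R 0 xpredT) => // -[x y].
exact: add_continuous.
Qed.

(** Dominated convergence for sums of growing length: cut at [K] such that the
tail of [g] from [K] on is at most [e / 3]; this tail controls both the tail of
the limit series and that of the [n]-th sum. *)
Lemma tannery (f : nat -> nat -> R) (f0 g : nat -> R) :
  (\forall n \near \oo, forall l, (l <= n)%N -> `|f n l| <= g l) ->
  (forall l, f n l @[n --> \oo] --> f0 l) ->
  cvgn (series g) ->
  cvgn (series f0) /\
  \sum_(l < n.+1) f n l @[n --> \oo] --> limn (series f0).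
Proof.
move=> fg ff0 cg.
have f0g l : `|f0 l| <= g l.
  rewrite -(cvg_lim _ (cvg_norm (ff0 l))) //.
  apply: limr_le; first by apply/cvg_ex; exists `|f0 l|; exact: cvg_norm.
  near=> n; apply: (near fg n) => //; near: n; exact: nbhs_infty_ge.
have g0 l : 0 <= g l by exact: le_trans (f0g l).
have cf0 : cvgn (series f0).
  by apply: normed_cvg; apply: series_le_cvg cg => // l; exact: normr_ge0.
split=> //.
have tail (K N : nat) : (K <= N)%N ->
    \sum_(K <= l < N) g l <= limn (series g) - series g K.
  move=> KN; rewrite -(sub_series_geq _ KN) lerD2r.
  by apply: nondecreasing_cvgn_le => //; apply: nondecreasing_series => i _ _.
have tailf (K : nat) : `|limn (series f0) - series f0 K| <= limn (series g) - series g K.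
  have cK : (fun N => `|series f0 N - series f0 K|) @ \oo -->
      `|limn (series f0) - series f0 K|.
    by apply: cvg_norm; apply: cvgB => //; exact: cvg_cst.
  rewrite -(cvg_lim _ cK) //; apply: limr_le; first by apply/cvg_ex; eexists; exact: cK.
  near=> N.
  have KN : (K <= N)%N by near: N; exact: nbhs_infty_ge.
  rewrite sub_series_geq //; apply: le_trans (tail _ _ KN).
  by apply: le_trans (ler_norm_sum _ _ _) _; apply: ler_sum.
apply/cvgrPdist_le => e e0.
have e30 : 0 < e / 3 by rewrite divr_gt0.
have /cvgrPdist_le/(_ _ e30) [K _ gK] : series g @ \oo --> limn (series g) by [].
have {}gK : limn (series g) - series g K <= e / 3.
  by apply: le_trans (gK K _) => //=; exact: ler_norm.
have cK : \sum_(l < K) (f0 l - f n l) @[n --> \oo] --> (0 : R).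
  rewrite -[X in _ --> X](_ : \sum_(l < K) (f0 l - f0 l) = 0); last first.
    by rewrite big1 // => l _; rewrite subrr.
  apply: (@cvgn_sum _ _ (fun (l : 'I_K) n => f0 l - f n l)) => l.
  by apply: cvgB => //; exact: cvg_cst.
near=> n.
have Kn : (K <= n.+1)%N by apply: leqW; near: n; exact: nbhs_infty_ge.
have fgn l : (l <= n)%N -> `|f n l| <= g l by move: l; near: n.
have K3 : `|\sum_(l < K) (f0 l - f n l)| <= e / 3.
  rewrite -normrN -[- _]sub0r; near: n.
  by move/cvgrPdist_le : cK => /(_ _ e30).
rewrite -(big_mkord xpredT (f n)) (big_cat_nat (leq0n K) Kn) //= big_mkord.
have -> : limn (series f0) - (\sum_(i < K) f n i + \sum_(K <= i < n.+1) f n i) =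
  (limn (series f0) - series f0 K) + \sum_(l < K) (f0 l - f n l)
    - \sum_(K <= i < n.+1) f n i.
  by rewrite sumrB /series /= big_mkord; ring.
rewrite (_ : e = e / 3 + e / 3 + e / 3); last by field.
apply: le_trans (ler_normB _ _) _; apply: lerD.
  apply: le_trans (ler_normD _ _) _; apply: lerD => //.
  exact: le_trans (tailf K) gK.
apply: le_trans (ler_norm_sum _ _ _) _.
apply: le_trans gK; apply: le_trans (tail _ _ Kn).
rewrite big_nat [leRHS]big_nat; apply: ler_sum => i /andP[_ iN].
exact: fgn.
Unshelve. all: by end_near.
Qed.

Lemma expR_gt_square (t : R) : 0 <= t -> t ^+ 2 / 4 <= expR t.
Proof.
move=> t0; rewrite [t in expR t]splitr expRD.
have h := expR_ge1Dx (t / 2).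
have -> : t ^+ 2 / 4 = (t / 2) * (t / 2) by field.
by apply: ler_pM; rewrite ?divr_ge0 //; apply: le_trans h; rewrite lerDr.
Qed.

Lemma bernoulli_le (x : R) k : 0 <= x <= 1 -> 1 - k%:R * (1 - x) <= x ^+ k.
Proof.
move=> /andP[x0 x1]; elim: k => [|k IH]; first by rewrite expr0 mul0r subr0.
rewrite exprS; have : x * (1 - k%:R * (1 - x)) <= x * x ^+ k by rewrite ler_wpM2l.
apply: le_trans; rewrite -natr1.
have : 0 <= k%:R * (1 - x) ^+ 2 by rewrite mulr_ge0 // sqr_ge0.
by rewrite -subr_ge0 => ?; rewrite -subr_ge0; lra.
Qed.

Lemma bin_le_exp2 r j : ('C(r, j) <= 2 ^ r)%N.
Proof.
elim: r j => [|r IH] [|j] //.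
  by rewrite bin0 expn_gt0.
by rewrite binS expnS mul2n -addnn leq_add.
Qed.

(** Each binomial coefficient is at least 1. *)
Lemma sum_exp_le (y : R) l : 0 <= y -> \sum_(j < l.+1) y ^+ j <= (1 + y) ^+ l.
Proof.
move=> y0; rewrite exprDn; apply: ler_sum => j _.
rewrite expr1n mul1r -mulr_natr ler_peMr ?exprn_ge0 // ler1n bin_gt0 -ltnS //.
Qed.

End Analysis.

(** * Factorial moments *)
Section Moments.
Variable R : realType.

(** Ratio of two consecutive factorial moments, see [fact_momentS]. *)
Definition moment_factor (n m k r : nat) : R :=
  (n - r)%N%:R * ((n - r - m)%N%:R / (n - r)%N%:R) ^+ k.

Definition fact_moment (n m k r : nat) : R :=
  r`!%:R * ('C(n, r)%:R * ('C(n - r, m)%:R / 'C(n, m)%:R) ^+ k).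

(** The quantity lambda_n: the expected number of untouched cards. *)
Definition mean_untouched (n m k : nat) : R := n%:R * ((n%:R - m%:R) / n%:R) ^+ k.

Lemma mean_untouched_ge0 n m k : (m <= n)%N -> 0 <= mean_untouched n m k.
Proof.
by move=> mn; rewrite mulr_ge0 // exprn_ge0 // divr_ge0 // subr_ge0 ler_nat.
Qed.

Lemma moment_factor_ge0 n m k r : 0 <= moment_factor n m k r.
Proof. by rewrite mulr_ge0 // exprn_ge0 // divr_ge0. Qed.

Lemma moment_factor_le n m k r : (m <= n)%N ->
  moment_factor n m k r <= mean_untouched n m k.
Proof.
move=> mn; have [rn|nr] := ltnP r n; last first.
  rewrite /moment_factor (_ : n - r = 0)%N; last by lia.
  by rewrite mul0r mean_untouched_ge0.
rewrite /moment_factor /mean_untouched -natrB //.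
apply: ler_pM => //; rewrite ?exprn_ge0 ?divr_ge0 // ?ler_nat ?leq_subr //.
apply: lerXn2r; rewrite ?nnegrE ?divr_ge0 //.
rewrite ler_pdivrMr ?ltr0n ?subn_gt0 // mulrAC ler_pdivlMr ?ltr0n; last by lia.
rewrite -!natrM ler_nat.
have [E|E] := leqP (r + m) n; nia.
Qed.

Lemma fact_moment0 n m k : (m <= n)%N -> fact_moment n m k 0 = 1.
Proof.
move=> mn; rewrite /fact_moment subn0 bin0 divff ?expr1n ?mulr1 ?mul1r //.
by rewrite pnatr_eq0 -lt0n bin_gt0.
Qed.

Lemma fact_momentS n m k r : (m <= n)%N ->
  fact_moment n m k r.+1 = fact_moment n m k r * moment_factor n m k r.
Proof.
move=> mn; rewrite /fact_moment /moment_factor.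
have [rn|nr] := ltnP r n; last first.
  have /eqP -> : (n - r == 0)%N by rewrite subn_eq0.
  by rewrite (@bin_small n r.+1) // !mul0r !mulr0.
have E1 : ((r.+1)`! * 'C(n, r.+1) = r`! * 'C(n, r) * (n - r))%N.
  by rewrite factS -mulnA mulnCA mul_bin_left; ring.
have E2 : ((n - r) * 'C(n - r.+1, m) = (n - r - m) * 'C(n - r, m))%N.
  by rewrite subnS mul_bin_down.
have E1' : (r.+1)`!%:R * 'C(n, r.+1)%:R = r`!%:R * 'C(n, r)%:R * (n - r)%N%:R :> R.
  by rewrite -!natrM E1.
have E2' : (n - r)%N%:R * 'C(n - r.+1, m)%:R = (n - r - m)%N%:R * 'C(n - r, m)%:R :> R.
  by rewrite -!natrM E2.
have nr0 : (n - r)%N%:R != 0 :> R by rewrite pnatr_eq0 -lt0n subn_gt0.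
rewrite mulrA E1'.
have -> : 'C(n - r.+1, m)%:R = (n - r - m)%N%:R / (n - r)%N%:R * 'C(n - r, m)%:R :> R.
  by rewrite mulrAC -E2' mulrAC mulfV ?mul1r.
rewrite -[(n - r - m)%N%:R / _ * _ / _]mulrA exprMn; ring.
Qed.

Lemma fact_moment_bounds n m k r : (m <= n)%N ->
  0 <= fact_moment n m k r <= mean_untouched n m k ^+ r.
Proof.
move=> mn; elim: r => [|r /andP[IH0 IH]].
  by rewrite fact_moment0 // expr0 ler01 lexx.
rewrite fact_momentS // mulr_ge0 ?moment_factor_ge0 //= exprSr.
by apply: ler_pM => //; rewrite ?moment_factor_ge0 ?moment_factor_le.
Qed.

(** The ratio [(n-r-m)/(n-r)] is [(n-m)/n] times [1 - r m / ((n-r)(n-m))]. The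
[k]-th power of the last factor is bounded by Bernoulli, and [n <= 2 (n - r)]
replaces [n - r] by [n]. *)
Lemma moment_factor_ge n m k r : (m < n)%N -> (r.*2 < n)%N ->
  (r + m <= n)%N ->
  mean_untouched n m k * (1 - r%:R / n%:R) *
    (1 - 2 * r%:R * (k%:R * (m%:R / (n%:R * (n - m)%N%:R)))) <=
  moment_factor n m k r.
Proof.
move=> mn rn rmn.
have n0 : 0 < n%:R :> R by rewrite ltr0n; lia.
have nr0 : 0 < (n - r)%N%:R :> R by rewrite ltr0n; lia.
have nm0 : 0 < (n - m)%N%:R :> R by rewrite ltr0n; lia.
(* correction factor between the avoidance ratios for n - r and for n *)
pose rho : R := 1 - r%:R * m%:R / ((n - r)%N%:R * (n - m)%N%:R).
have q_rho : (n - r - m)%N%:R / (n - r)%N%:R = (n%:R - m%:R) / n%:R * rho.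
  rewrite /rho; move: nr0 nm0; rewrite -subnDA !natrB ?natrD; try lia.
  by move=> nr0 nm0; field; rewrite !gt_eqF.
have rho_le1 : rho <= 1 by rewrite gerBl divr_ge0 // mulr_ge0 // ltW.
have rho_ge0 : 0 <= rho.
  have : 0 <= (n - r - m)%N%:R / (n - r)%N%:R :> R by rewrite divr_ge0.
  by rewrite q_rho pmulr_rge0 // -natrB ?divr_gt0 // ltnW.
have -> : moment_factor n m k r = mean_untouched n m k * (1 - r%:R / n%:R) * rho ^+ k.
  rewrite /moment_factor q_rho exprMn /mean_untouched natrB; last by lia.
  have -> : n%:R - r%:R = n%:R * (1 - r%:R / n%:R) :> R by field; rewrite gt_eqF.
  ring.
apply: ler_wpM2l.
  rewrite mulr_ge0 ?mean_untouched_ge0 ?(ltnW mn) // subr_ge0.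
  by rewrite ler_pdivrMr // mul1r ler_nat; lia.
apply: le_trans (bernoulli_le k _); last by rewrite rho_ge0.
rewrite lerD2l lerN2 /rho.
have -> : k%:R * (1 - (1 - r%:R * m%:R / ((n - r)%N%:R * (n - m)%N%:R))) =
    (r%:R * k%:R * m%:R / (n - m)%N%:R) / (n - r)%N%:R :> R.
  by field; rewrite !gt_eqF.
have -> : 2 * r%:R * (k%:R * (m%:R / (n%:R * (n - m)%N%:R))) =
    (r%:R * k%:R * m%:R / (n - m)%N%:R) * (2 / n%:R) :> R.
  by field; rewrite !gt_eqF.
apply: ler_wpM2l; first by rewrite divr_ge0 // !mulr_ge0.
rewrite ler_pdivlMr // mulrC ler_pdivrMr // -natrM ler_nat; lia.
Qed.

(** This makes the error term of [moment_factor_ge] vanish as [n - m] grows.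
With [h = n - m], [q = h / n] and [t = (k-1) (1-q)], where [k >= 1], the left
side is [t / h + (1 - q) / h]. As [lambda_n = h q^(k-1)] and [q <= exp (q -
1)], one has [t^2 / 4 <= exp t <= h / lambda_n], that is [(t / h)^2 <= 4 /
(lambda_n h)]. *)
Lemma collision_rate_le (n m k : nat) : (m < n)%N ->
  k%:R * (m%:R / (n%:R * (n - m)%N%:R)) <=
  Num.sqrt (4 / mean_untouched n m k * (n - m)%N%:R^-1) + (n - m)%N%:R^-1 :> R.
Proof.
move=> mn; case: k => [|k].
  by rewrite mul0r addr_ge0 // ?sqrtr_ge0 // invr_ge0.
have n0 : 0 < n%:R :> R by rewrite ltr0n; lia.
set h : R := (n - m)%N%:R.
have h0 : 0 < h by rewrite ltr0n; lia.
have hE : h = n%:R - m%:R by rewrite /h natrB // ltnW.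
pose q : R := h / n%:R; pose t : R := k%:R * (1 - q).
have q0 : 0 < q by rewrite divr_gt0.
have mE : m%:R / n%:R = 1 - q by rewrite /q hE; field; rewrite gt_eqF.
have q1 : 0 <= 1 - q <= 1.
  by rewrite -mE divr_ge0 //= ler_pdivrMr // mul1r ler_nat ltnW.
have lamE : mean_untouched n m k.+1 = h * q ^+ k.
  by rewrite /mean_untouched -hE -/q exprS mulrA /q mulrCA mulfV ?mulr1 // gt_eqF.
have lam0 : 0 < mean_untouched n m k.+1 by rewrite lamE mulr_gt0 // exprn_gt0.
have t0 : 0 <= t by rewrite mulr_ge0 //; case/andP: q1.
have qk : q ^+ k <= expR (- t).
  have -> : - t = k%:R * (q - 1) by rewrite /t; ring.
  rewrite expRM_natl; apply: lerXn2r; rewrite ?nnegrE ?expR_ge0 ?(ltW q0) //.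
  by apply: le_trans (expR_ge1Dx _); rewrite addrC subrK.
have lt : mean_untouched n m k.+1 * expR t <= h.
  rewrite lamE -mulrA ger_pMr //.
  by rewrite -[t]opprK expRN -ler_pdivlMr ?invr_gt0 ?expR_gt0 // invrK mul1r.
have t2 : (t / h) ^+ 2 <= 4 / mean_untouched n m k.+1 * h^-1.
  have lt2 : mean_untouched n m k.+1 * (t ^+ 2 / 4) <= h.
    by apply: le_trans lt; apply: ler_wpM2l; [exact: ltW | exact: expR_gt_square].
  rewrite ler_pdivlMr // ler_pdivlMr //.
  have -> : (t / h) ^+ 2 * h * mean_untouched n m k.+1 =
      4 * (mean_untouched n m k.+1 * (t ^+ 2 / 4)) / h.
    by field; rewrite gt_eqF.
  by rewrite ler_pdivrMr // ler_wpM2l.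
have tl : t / h <= Num.sqrt (4 / mean_untouched n m k.+1 * h^-1).
  by rewrite -[t / h]ger0_norm ?divr_ge0 ?(ltW h0) // -sqrtr_sqr ler_wsqrtr.
have -> : k.+1%:R * (m%:R / (n%:R * h)) = t / h + (1 - q) / h.
  rewrite /t -mE -natr1; field; by rewrite !gt_eqF.
by apply: lerD => //; rewrite ler_piMl ?invr_ge0 ?(ltW h0) //; case/andP: q1.
Qed.

End Moments.

(** * Poisson limit of the number of untouched cards *)
Section PoissonLimit.
Variable R : realType.
Variables (m k : nat -> nat) (lam : R).
Hypothesis hm : forall n, (2 <= n)%N -> (1 <= m n <= n - 1)%N.
Hypothesis lam_gt0 : 0 < lam.
Hypothesis mean_cvg : mean_untouched R n (m n) (k n) @[n --> \oo] --> lam.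
Hypothesis rest_cvg : (n - m n)%N @[n --> \oo] --> \oo.

Lemma near_block_lt : \forall n \near \oo, (m n < n)%N.
Proof.
near=> n; have n2 : (2 <= n)%N by near: n; exact: nbhs_infty_ge.
by have := hm n2; lia.
Unshelve. all: by end_near. Qed.

Lemma cvg_inv_rest : (n - m n)%N%:R^-1 @[n --> \oo] --> (0 : R).
Proof.
apply/gtr0_cvgV0; last by apply/cvgrnyP.
by near=> n; rewrite ltr0n subn_gt0; near: n; exact: near_block_lt.
Unshelve. all: by end_near. Qed.

Lemma cvg_inv_nat : n%:R^-1 @[n --> \oo] --> (0 : R).
Proof.
apply/gtr0_cvgV0; last by apply/cvgrnyP; exact: cvg_id.
by near=> n; rewrite ltr0n; near: n; exact: nbhs_infty_gt.
Unshelve. all: by end_near. Qed.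

Lemma cvg_collision_rate :
  (k n)%:R * ((m n)%:R / (n%:R * (n - m n)%N%:R)) @[n --> \oo] --> (0 : R).
Proof.
have up : Num.sqrt (4 / mean_untouched R n (m n) (k n) * (n - m n)%N%:R^-1) +
    (n - m n)%N%:R^-1 @[n --> \oo] --> (0 : R).
  rewrite -[X in _ --> X](_ : Num.sqrt 0 + 0 = 0); last by rewrite sqrtr0 addr0.
  apply: cvgD; last exact: cvg_inv_rest.
  apply: continuous_cvg; first exact: sqrt_continuous.
  rewrite -[X in _ --> X](mulr0 (4 / lam)).
  apply: cvgM; last exact: cvg_inv_rest.
  by apply: cvgM; [exact: cvg_cst | apply: cvgV => //; rewrite gt_eqF].
apply: (squeeze_cvgr _ (cvg_cst 0) up).
near=> n; rewrite mulr_ge0 ?divr_ge0 ?mulr_ge0 //=.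
by apply: collision_rate_le; near: n; exact: near_block_lt.
Unshelve. all: by end_near. Qed.

(** Squeezed between [moment_factor_ge] and [moment_factor_le]. *)
Lemma cvg_moment_factor r : moment_factor R n (m n) (k n) r @[n --> \oo] --> lam.
Proof.
have low : mean_untouched R n (m n) (k n) * (1 - r%:R / n%:R) *
    (1 - 2 * r%:R * ((k n)%:R * ((m n)%:R / (n%:R * (n - m n)%N%:R))))
    @[n --> \oo] --> lam.
  rewrite -[X in _ --> X](_ : lam * (1 - r%:R * 0) * (1 - 2 * r%:R * 0) = lam);
    last by ring.
  apply: cvgM; first apply: cvgM => //.
    by apply: cvgB; [exact: cvg_cst|apply: cvgM; [exact: cvg_cst|exact: cvg_inv_nat]].
  apply: cvgB; first exact: cvg_cst.
  by apply: cvgM; [exact: cvg_cst|exact: cvg_collision_rate].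
apply: (squeeze_cvgr _ low mean_cvg).
have rest_r : \forall n \near \oo, (r <= n - m n)%N by move/cvgnyPge : rest_cvg; exact.
near=> n.
have mn : (m n < n)%N by near: n; exact: near_block_lt.
have rn : (r.*2 < n)%N by near: n; exact: nbhs_infty_gt.
rewrite moment_factor_le ?(ltnW mn) // andbT moment_factor_ge //.
by rewrite addnC -leq_subRL ?(ltnW mn) //; near: n.
Unshelve. all: by end_near. Qed.

Lemma cvg_fact_moment r : fact_moment R n (m n) (k n) r @[n --> \oo] --> lam ^+ r.
Proof.
have mn : \forall n \near \oo, (m n <= n)%N.
  by near=> n; apply: ltnW; near: n; exact: near_block_lt.
elim: r => [|r IH].
  rewrite expr0; apply: (@near_eq_cvgn R (fun=> 1)); last exact: cvg_cst.
  by near=> n; rewrite fact_moment0 //=; near: n.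
rewrite exprSr; apply: (near_eq_cvgn _ (cvgM IH (cvg_moment_factor r))).
by near=> n; rewrite fact_momentS //=; near: n.
Unshelve. all: by end_near. Qed.

Lemma near_mean_le : \forall n \near \oo, mean_untouched R n (m n) (k n) <= lam + 1.
Proof. by apply: (cvgr_le lam) => //; rewrite ltrDl. Qed.

(** Inclusion-exclusion writes the law as an alternating sum of factorial
moments; its terms are dominated by [(2 (lambda + 1))^r / r!], so the limit can
be taken termwise, and the limit series is an exponential series shifted by
[j]. *)
Lemma cvg_untouched_law j :
  untouched_law R n (m n) (k n) j @[n --> \oo] --> expR (- lam) * lam ^+ j / j`!%:R.
Proof.
pose f n r : R := (-1) ^+ (r - j) *+ 'C(r, j) *
   ('C(n, r)%:R * ('C(n - r, m n)%:R / 'C(n, m n)%:R) ^+ k n).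
pose f0 r : R := (-1) ^+ (r - j) *+ 'C(r, j) * (lam ^+ r / r`!%:R).
have fE n r : f n r =
    (-1) ^+ (r - j) *+ 'C(r, j) / r`!%:R * fact_moment R n (m n) (k n) r.
  by rewrite /f /fact_moment [RHS]mulrA mulfVK // pnatr_eq0 -lt0n fact_gt0.
have [|||_] := @tannery R f f0 (exp_coeff (2 * (lam + 1))).
- near=> n => r rn.
  have mn : (m n <= n)%N by apply: ltnW; near: n; exact: near_block_lt.
  have /andP[b0 b1] := fact_moment_bounds R (k n) r mn.
  rewrite fE normrM (ger0_norm b0) normrM /exp_coeff /= exprMn.
  rewrite -mulr_natr normrM normrX normrN1 expr1n mul1r ger0_norm // normfV ger0_norm //.
  rewrite mulrAC ler_wpM2r ?invr_ge0 //.
  apply: ler_pM => //; first by rewrite -natrX ler_nat bin_le_exp2.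
  apply: le_trans b1 _; apply: lerXn2r; rewrite ?nnegrE ?mean_untouched_ge0 //.
    by rewrite addr_ge0 // ltW.
  by near: n; exact: near_mean_le.
- move=> r; under eq_fun do rewrite fE.
  have -> : f0 r = (-1) ^+ (r - j) *+ 'C(r, j) / r`!%:R * lam ^+ r.
    by rewrite /f0 mulrA mulrAC.
  by apply: cvgM; [exact: cvg_cst|exact: cvg_fact_moment].
- exact: is_cvg_series_exp_coeff.
have -> : limn (series f0) = expR (- lam) * lam ^+ j / j`!%:R.
  apply: cvg_lim => //; rewrite -(cvg_shiftn j).
  have -> : [sequence series f0 (n + j)%N]_n =
      (fun n => series (exp_coeff (- lam)) n * (lam ^+ j / j`!%:R)).
    apply/funext => n /=.
    rewrite /series /= addnC (big_cat_nat (leq0n j) (leq_addr _ _)) //=.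
    rewrite big_nat big1 ?add0r; last first.
      by move=> r /andP[_ rj]; rewrite /f0 bin_small // mulr0n mul0r.
    rewrite -{1}[j]add0n big_addn addKn mulr_suml; apply: eq_bigr => s _.
    rewrite /f0 /exp_coeff /= addnK exprD (exprNn lam).
    have sE : ((s + j)`! = 'C(s + j, j) * (j`! * s`!))%N.
      by rewrite -(@bin_fact (s + j) j) ?leq_addl // addnK.
    rewrite -mulr_natr sE !natrM.
    have h1 : 'C(s + j, j)%:R != 0 :> R by rewrite pnatr_eq0 -lt0n bin_gt0 leq_addl.
    have h2 : j`!%:R != 0 :> R by rewrite pnatr_eq0 -lt0n fact_gt0.
    have h3 : s`!%:R != 0 :> R by rewrite pnatr_eq0 -lt0n fact_gt0.
    by field; rewrite h1 h2 h3.
  rewrite -mulrA; apply: cvgM; last exact: cvg_cst.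
  exact: is_cvg_series_exp_coeff.
apply: near_eq_cvgn; near=> n.
rewrite untouched_law_inversion //.
by near: n; exact: nbhs_infty_ge.
Unshelve. all: by end_near. Qed.

End PoissonLimit.

(** * Limits of the distances *)
Section Limits.
Variable R : realType.
Variable p : nat.
Hypothesis p_gt0 : (0 < p)%N.

Lemma tail_coef_ge0 l : 0 <= tail_coef R p l.
Proof. by rewrite invr_ge0 mulr_ge0 // exprn_ge0. Qed.

Lemma tail_coef_le l : tail_coef R p l <= (l`!%:R)^-1.
Proof.
rewrite lef_pV2 ?posrE ?mulr_gt0 ?exprn_gt0 ?ltr0n ?fact_gt0 //.
by rewrite ler_peMr // exprn_ege1 // ler1n.
Qed.

Lemma a_coef_ge0 l : 0 <= a_coef R p l.
Proof.
rewrite subr_ge0 lef_pV2 ?posrE ?mulr_gt0 ?exprn_gt0 ?ltr0n ?fact_gt0 //.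
by rewrite -!natrX -!natrM ler_nat factS expnS; nia.
Qed.

Lemma level_law_bounds n l : 0 <= level_law R n p l <= (l`!%:R)^-1.
Proof.
rewrite /level_law; case: eqP => [->|_]; first by rewrite tail_coef_ge0 tail_coef_le.
rewrite a_coef_ge0 /=; apply: le_trans (tail_coef_le l).
by rewrite gerBl tail_coef_ge0.
Qed.

Lemma cvg_level_law l : level_law R n p l @[n --> \oo] --> a_coef R p l.
Proof.
apply: (@near_eq_cvgn R (fun=> a_coef R p l)); last exact: cvg_cst.
near=> n; rewrite /level_law ltn_eqF //; near: n; exact: nbhs_infty_gt.
Unshelve. all: by end_near. Qed.

Lemma sum_shuffle_pow n m k : (m <= n)%N ->
  \sum_(x : wreath n p) convolution_pow (shuffle_law m R) k x = 1.
Proof.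
move=> mn; under eq_bigr do rewrite shuffle_pow_law //.
rewrite exchange_big /=.
transitivity (\sum_(j < n.+1) untouched_law R n m k j * 'C(j, 0)%:R); last first.
  rewrite untouched_law_moment bin0 subn0 divff ?expr1n ?mulr1 //.
  by rewrite pnatr_eq0 -lt0n bin_gt0.
apply: eq_bigr => j _; rewrite bin0 -mulr_sumr; congr (_ * _).
have jn : (j <= n)%N by rewrite -ltnS.
rewrite /bottom_law -mulr_suml -mulr_suml.
have := card_undisturbed p (bottom_cards n j).
rewrite card_parabolic // card_bottom // card_wreath // => E.
have -> : \sum_(x : wreath n p) (undisturbed (bottom_cards n j) x)%:R =
   #|[set x : wreath n p | undisturbed (bottom_cards n j) x]%SET|%:R :> R.
  rewrite -sum1dep_card natr_sum [RHS]big_mkcond.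
  by apply: eq_bigr => x _; case: ifP.
rewrite -natrM E divff // pnatr_eq0 -lt0n muln_gt0 fact_gt0 expn_gt0 p_gt0 //.
Qed.

(** For two probability laws the positive and the negative part of the
difference have the same total mass: [|t - 1| = 2 max (t - 1) 0 - (t - 1)] and
the last term has integral 0. *)
Lemma tv_dist_phi_div n (M : wreath n p -> R) : \sum_x M x = 1 ->
  tv_dist M (unif_law R) = phi_div (fun t => Num.max (t - 1) 0) M (unif_law R).
Proof.
move=> M1; set U : wreath n p -> R := unif_law R.
have U0 x : 0 < U x.
  by rewrite /U unif_lawE // invr_gt0 mulr_gt0 ?exprn_gt0 ?ltr0n ?fact_gt0.
have U1 : \sum_x U x = 1.
  rewrite /U /unif_law sumr_const -[_ *+ _]mulr_natr mulVf // pnatr_eq0 -lt0n.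
  by apply/card_gt0P; exists 1%g.
rewrite /tv_dist /phi_div.
have -> : \sum_x `|M x - U x| =
    \sum_x (2 * (U x * Num.max (M x / U x - 1) 0) - (M x - U x)).
  apply: eq_bigr => x _; have Ux := U0 x.
  have ME : M x = M x / U x * U x by rewrite divfK // gt_eqF.
  move: (M x / U x) ME => y ->.
  have -> : y * U x - U x = U x * (y - 1) by ring.
  rewrite normrM (gtr0_norm Ux).
  by case: (leP (y - 1) 0) => h; [rewrite ler0_norm // | rewrite gtr0_norm //]; ring.
by rewrite sumrB sumrB M1 U1 subrr subr0 -mulr_sumr mulrA mulVf ?mul1r // pnatr_eq0.
Qed.

Lemma poly_growth_pos_part : poly_growth (fun t : R => Num.max (t - 1) 0).
Proof.
exists 1, 1; split => // t t0; rewrite powRr1 // mul1r ger0_norm ?le_max ?lexx ?orbT //.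
by rewrite ge_max; apply/andP; split; lra.
Qed.

Lemma continuous_pos_part : continuous (fun t : R => Num.max (t - 1) 0).
Proof.
move=> t; apply: (@continuous_max _ _ (fun t : R => t - 1) (fun=> 0) t).
  by apply: cvgB; [exact: cvg_id|exact: cvg_cst].
exact: cst_continuous.
Qed.

Variables (m k : nat -> nat) (lam : R).
Hypothesis hm : forall n, (2 <= n)%N -> (1 <= m n <= n - 1)%N.
Hypothesis lam_gt0 : 0 < lam.
Hypothesis mean_cvg : mean_untouched R n (m n) (k n) @[n --> \oo] --> lam.
Hypothesis rest_cvg : (n - m n)%N @[n --> \oo] --> \oo.

Let D n := density p (untouched_law R n (m n) (k n)).
Let M n : wreath n p -> R := convolution_pow (shuffle_law (m n) R) (k n).
Let U n : wreath n p -> R := unif_law R.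

Lemma cvg_density l : D n l @[n --> \oo] --> s_level p lam l.
Proof.
rewrite /s_level big_mkord mulr_sumr.
apply: (@cvgn_sum _ _ _ (fun (j : 'I_l.+1) n =>
  untouched_law R n (m n) (k n) j * (j`!%:R * p%:R ^+ j))) => j.
have -> : expR (- lam) * (p%:R * lam) ^+ j =
   expR (- lam) * lam ^+ j / j`!%:R * (j`!%:R * p%:R ^+ j).
  by rewrite exprMn; field; rewrite pnatr_eq0 -lt0n fact_gt0.
by apply: cvgM; [exact: cvg_untouched_law|exact: cvg_cst].
Qed.

Lemma density_ge0 n l : 0 <= D n l.
Proof.
apply: sumr_ge0 => j _.
by rewrite mulr_ge0 ?untouched_law_ge0 // mulr_ge0 // exprn_ge0.
Qed.

Lemma near_density_le : \forall n \near \oo, forall l, (l <= n)%N ->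
  D n l <= (1 + p%:R * (lam + 1)) ^+ l.
Proof.
have lam1 : 0 <= lam + 1 by rewrite addr_ge0 // ltW.
near=> n => l ln.
have mn : (m n <= n)%N by apply: ltnW; near: n; exact: near_block_lt.
apply: le_trans (sum_exp_le _ _); last by rewrite mulr_ge0.
apply: ler_sum => j _; rewrite mulrA exprMn mulrC.
rewrite ler_wpM2l ?exprn_ge0 //.
have jn : (j <= n)%N by apply: leq_trans ln; rewrite -ltnS.
apply: le_trans (untouched_law_fact_le R (m n) (k n) jn) _.
have /andP[_ b1] := fact_moment_bounds R (k n) j mn.
apply: le_trans b1 _; apply: lerXn2r; rewrite ?nnegrE ?mean_untouched_ge0 //.
by near: n; exact: near_mean_le.
Unshelve. all: by end_near. Qed.

Lemma s_level_gt0 l : 0 < s_level p lam l.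
Proof.
rewrite mulr_gt0 ?expR_gt0 // big_mkord big_ord_recl expr0.
rewrite ltr_wpDr // sumr_ge0 // => i _.
by rewrite exprn_ge0 // mulr_ge0 // ltW.
Qed.

Lemma near_phi_div (Phi : R -> R) : \forall n \near \oo,
  \sum_(l < n.+1) level_law R n p l * Phi (D n l) = phi_div Phi (@M n) (@U n).
Proof.
near=> n; rewrite (phi_div_level p_gt0 (P := untouched_law R n (m n) (k n))) // => x.
apply: shuffle_pow_density => //; apply: ltnW; near: n; exact: near_block_lt.
Unshelve. all: by end_near. Qed.

(** The terms are dominated by [2 C B^l / l!] with [B = (1 + p (lambda +
1))^d], because the bound [near_density_le] is geometric in [l] and polynomial
growth keeps it geometric. The limits [s_level] are positive, hence interior to
the domain on which [Phi] is continuous. *)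
Lemma cvg_phi_div (Phi : R -> R) :
  {within `[0, +oo[, continuous Phi} -> poly_growth Phi ->
  cvgn (series (phi_lim_term Phi p lam)) /\
  phi_div Phi (@M n) (@U n) @[n --> \oo] --> phi_lim Phi p lam.
Proof.
move=> /continuous_within_itvcyP[cPhi _] [C [d [C0 d0 PhiC]]].
pose b : R := 1 + p%:R * (lam + 1).
have b1 : 1 <= b by rewrite lerDl mulr_ge0 // addr_ge0 // ltW.
have b0 : 0 <= b by apply: le_trans b1.
have bd1 : 1 <= b `^ d.
  by have := ge0_ler_powR d0 _ _ b1; rewrite powR1; apply; rewrite nnegrE.
have [||| cS cv] := @tannery R (fun n l => level_law R n p l * Phi (D n l))
    (phi_lim_term Phi p lam) (fun l => 2 * C * exp_coeff (b `^ d) l).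
- near=> n => l ln.
  have /andP[l0 l1] := level_law_bounds n l.
  rewrite normrM (ger0_norm l0) mulrC.
  rewrite /= [leRHS](_ : _ = (2 * C * (b `^ d) ^+ l) * (l`!%:R)^-1); last first.
    by rewrite /exp_coeff /= mulrA.
  apply: ler_pM => //; apply: le_trans (PhiC _ (density_ge0 _ _)) _.
  rewrite [2 * C]mulrC -mulrA ler_wpM2l ?(ltW C0) //.
  rewrite mulr2n mulrDl mul1r; apply: lerD; first exact: exprn_ege1.
  rewrite -powR_mulrn ?powR_ge0 // powRAC powR_mulrn //.
  apply: ge0_ler_powR; rewrite ?nnegrE ?density_ge0 ?exprn_ge0 //.
  by move: l ln {l0 l1}; near: n; exact: near_density_le.
- move=> l; apply: cvgM; first exact: cvg_level_law.
  apply: continuous_cvg; last exact: cvg_density.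
  by apply: cPhi; rewrite in_itv /= s_level_gt0.
- have -> : series (fun l => 2 * C * exp_coeff (b `^ d) l) =
      (fun N => 2 * C * series (exp_coeff (b `^ d)) N).
    by apply/funext => N; rewrite /series /= mulr_sumr.
  apply/cvg_ex; exists (2 * C * limn (series (exp_coeff (b `^ d)))).
  by apply: cvgM; [exact: cvg_cst|exact: is_cvg_series_exp_coeff].
by split=> //; apply: near_eq_cvgn cv; exact: near_phi_div.
Unshelve. all: by end_near. Qed.

Lemma cvg_tv_dist :
  cvgn (series (tv_profile_term p (- ln lam))) /\
  tv_dist (@M n) (@U n) @[n --> \oo] --> tv_profile p (- ln lam).
Proof.
have tE : tv_profile_term p (- ln lam) = phi_lim_term (fun t => Num.max (t - 1) 0) p lam.
  by apply/funext => l; rewrite /tv_profile_term opprK lnK.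
have [c1 c2] := cvg_phi_div (continuous_subspaceT continuous_pos_part) poly_growth_pos_part.
rewrite /tv_profile tE; split => //.
apply: near_eq_cvgn c2; near=> n; rewrite tv_dist_phi_div //.
apply: sum_shuffle_pow; apply: ltnW; near: n; exact: near_block_lt.
Unshelve. all: by end_near. Qed.

(** Every deck has level at least 1 when [p = 1], since one card is always in
order and has color 0; when [p > 1], level 0 is attained by coloring the last
card. *)
Lemma cvg_sep_dist :
  sep_dist (@M n) (@U n) @[n --> \oo] -->
    (if p == 1%N then 1 - expR (- lam) * (1 + lam) else 1 - expR (- lam)).
Proof.
pose l0 : nat := (p == 1%N).
have -> : (if p == 1%N then 1 - expR (- lam) * (1 + lam) else 1 - expR (- lam)) =
    1 - s_level p lam l0.
  rewrite /s_level /l0; case: eqP => [->|_].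
    by rewrite big_mkord big_ord_recl big_ord1 expr0 expr1 mul1r.
  by rewrite big_mkord big_ord1 expr0 mulr1.
apply: (@near_eq_cvgn R (fun n => 1 - D n l0)); last first.
  by apply: cvgB; [exact: cvg_cst|exact: cvg_density].
near=> n; have n2 : (2 <= n)%N by near: n; exact: nbhs_infty_ge.
have mn : (m n <= n)%N by apply: ltnW; near: n; exact: near_block_lt.
have l01 : (l0 <= 1)%N by rewrite /l0; case: eqP.
symmetry; apply: (@sep_dist_level R n p (@M n) (untouched_law R n (m n) (k n))) => //.
- by move=> l; exact: untouched_law_ge0.
- by move=> x; exact: shuffle_pow_density.
- move=> x; rewrite /l0; case: eqP => // p1.
  rewrite -(@undisturbed_level n p x 1 (ltnW n2)); apply/undisturbedP.
  split=> [i _|i j]; last by rewrite !inE; have := ltn_ord j; lia.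
  by apply: val_inj => /=; have := ltn_ord (x.1 i); lia.
apply: (@exists_level R) => //; first by lia.
rewrite /level_law ltn_eqF; last by lia.
rewrite /l0 /a_coef; have [->|p1] := eqVneq p 1%N.
  rewrite !expr1n !mulr1 gt_eqF // subr_gt0.
  by rewrite ltf_pV2 ?posrE ?ltr0n ?fact_gt0 // ltr_nat.
rewrite fact0 (_ : 1`! = 1)%N // expr0 expr1 !mul1r gt_eqF // subr_gt0.
rewrite ltf_pV2 ?posrE ?ltr0n //.
by rewrite ltr1n; lia.
Unshelve. all: by end_near. Qed.

End Limits.

Unset Implicit Arguments.

Theorem theorem1p2 (R : realType) (p : nat) (hp : (1 <= p)%N)
  (m k : nat -> nat) (hm : forall n, (2 <= n)%N -> (1 <= m n <= n - 1)%N)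
  (lam : R) (hlam : 0 < lam)
  (hlim : (n%:R * ((n%:R - (m n)%:R) / n%:R) ^+ k n : R) @[n --> \oo] --> lam)
  (hrest : (n - m n)%N @[n --> \oo] --> \oo) :
  let M (n : nat) : wreath n p -> R :=
    convolution_pow (shuffle_law (m n) R) (k n) in
  let U (n : nat) : wreath n p -> R := unif_law R in
  [/\ forall Phi : R -> R,
        {within `[0, +oo[, continuous Phi} -> poly_growth Phi ->
        cvgn (series (phi_lim_term Phi p lam)) /\
        phi_div Phi (M n) (U n) @[n --> \oo] --> phi_lim Phi p lam,
      cvgn (series (tv_profile_term p (- ln lam))) /\
      tv_dist (M n) (U n) @[n --> \oo] --> tv_profile p (- ln lam)
    & sep_dist (M n) (U n) @[n --> \oo] -->
        (if p == 1%N then 1 - expR (- lam) * (1 + lam) else 1 - expR (- lam))].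
Proof.
move=> M U; split.
- by move=> Phi cPhi gPhi; exact: (cvg_phi_div hp hm hlam hlim hrest cPhi gPhi).
- exact: (cvg_tv_dist hp hm hlam hlim hrest).
- exact: (cvg_sep_dist hp hm hlam hlim hrest).
Qed.
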